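(* There is an absolute constant $A>0$ such that the following holds. Let $G$ be an $n$-vertex graph of Euler genus $g$ with diameter $D$ and maximum degree $\Delta$, and let $s\in V(G)$ be an arbitrary vertex. If $g\ln\Delta\le 36\sqrt{\Delta}\,(D+\ln n)$, then, with probability at least $1-A/n$, $$h(\mathcal{T}(G,s))\le 107\sqrt{\Delta}\,(2D+4\ln n).$$
   Context: All graphs are finite, simple, undirected and connected. The Euler genus of a graph is the minimum Euler genus of a surface on which the graph can be drawn without crossing edges. For a graph $G$ on $n$ vertices and $s\in V(G)$, build random subtrees $T_1,\dots,T_n$ of $G$: $T_1$ is the single vertex $s$, and for $1<i\le n$, $T_i$ is obtained from $T_{i-1}$ by choosing, uniformly at random, an edge of $G$ with exactly one endpoint in $T_{i-1}$ and adding it (with its other endpoint) to $T_{i-1}$. The random spanning tree $T_n$, rooted at $s$, is denoted $\mathcal{T}(G,s)$. The height $h(T)$ of a rooted tree $T$ is the maximum number of edges on a root-to-leaf path. $\ln$ is the natural logarithm. *)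

(* Defs.v *)
From HB Require Import structures.
From mathcomp Require Import all_boot all_order all_algebra.
From mathcomp Require Import all_classical all_reals all_analysis.

Set Implicit Arguments.
Unset Strict Implicit.
Unset Printing Implicit Defensive.

Import Order.TTheory GRing.Theory Num.Theory.
Import numFieldNormedType.Exports.

Local Open Scope ring_scope.

(** * Graphs

   A graph is an adjacency relation [e] on a finite type [T]; its edges are
   the two-element sets of adjacent vertices. *)

Section Graph.
Variables (T : finType) (e : rel T).

Definition simple_connected_graph : Prop :=
  [/\ symmetric e, irreflexive e & forall x y, connect e x y].

Definition edges : {set {set T}} :=
  [set [set p.1; p.2]%SET | p : T * T & e p.1 p.2]%SET.

Definition walk (x y : T) (k : nat) : bool :=
  [exists p : k.-tuple T, path e x p && (last x p == y)].

(* The least length of a walk from [x] to [y]; it is [#|T|] if there is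
   none, which does not happen in a connected graph. *)
Definition dist (x y : T) : nat := find (walk x y) (iota 0 #|T|).

Definition diameter : nat := (\max_(x : T) \max_(y : T) dist x y)%N.

Definition max_degree : nat := (\max_(x : T) #|[set y | e x y]%SET|)%N.

End Graph.

(** * The random spanning tree

   A subtree of the graph is represented by its vertex set and its set of
   edges. *)

Section RandomTree.
Variables (R : realType) (T : finType) (e : rel T) (s : T).

Definition subtree : finType := ({set T} * {set {set T}})%type.

Definition boundary (t : subtree) : {set {set T}} :=
  [set E in edges e | #|E :&: t.1| == 1%N]%SET.

Definition add_edge (t : subtree) (E : {set T}) : subtree :=
  ((t.1 :|: E)%SET, (E |: t.2)%SET).

(* [tree_law i t] is the probability that the tree obtained after [i] growth
   steps is [t]. *)
Fixpoint tree_law (i : nat) (t : subtree) : R :=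
  if i is j.+1 then
    \sum_(u : subtree) tree_law j u *
      (\sum_(E in boundary u) (add_edge u E == t)%:R / #|boundary u|%:R)
  else (t == ([set s]%SET, finset.set0))%:R.

(* The first tree is a single vertex, so the spanning tree is reached after
   [#|T| - 1] steps. *)
Definition spanning_tree_prob (P : pred subtree) : R :=
  \sum_(t : subtree | P t) tree_law #|T|.-1 t.

Definition tree_adj (t : subtree) : rel T :=
  [rel x y | (x != y) && ([set x; y]%SET \in t.2)].

(* In a tree rooted at [s], every vertex other than [s] lies on exactly one
   edge that leads to its parent; a leaf lies on no further edge. *)
Definition leaf (t : subtree) (x : T) : bool :=
  #|[set E in t.2 | x \in E]%SET| == (x != s) :> nat.

Definition root_to_leaf (t : subtree) (p : seq T) : bool :=
  [&& path (tree_adj t) s p, uniq (s :: p) & leaf t (last s p)].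

(* A path without repeated vertices has fewer than [#|T|] edges. *)
Definition height (t : subtree) : nat :=
  (\max_(k < #|T| | [exists p : k.-tuple T, root_to_leaf t p]) k)%N.

End RandomTree.

(** * Surfaces and Euler genus *)

(* Two-dimensional simplicial complexes on the vertex set ['I_N], given by
   their triangles. *)
Section Triangulation.
Variables (N : nat) (K : {set {set 'I_N}}).

(* the simplices with [d] vertices *)
Definition simplices (d : nat) : {set {set 'I_N}} :=
  [set A : {set 'I_N} | (#|A| == d) && [exists F in K, A \subset F]]%SET.

Definition euler_char : int :=
  #|simplices 1|%:Z - #|simplices 2|%:Z + #|simplices 3|%:Z.

Definition adjacent_triangles : rel {set 'I_N} :=
  [rel F F' | [&& F \in K, F' \in K & #|F :&: F'|%SET == 2]].

Definition adjacent_triangles_at (v : 'I_N) : rel {set 'I_N} :=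
  [rel F F' | [&& adjacent_triangles F F', v \in F & v \in F']].

(* The combinatorial form of a connected closed surface: each edge lies on
   two triangles, so that the link of a vertex is a disjoint union of cycles,
   and each link is a single cycle. *)
Definition closed_surface_complex : Prop :=
  [/\ K != finset.set0 /\ (forall F, F \in K -> #|F| = 3%N),
      forall A, A \in simplices 2 -> #|[set F in K | A \subset F]%SET| = 2%N,
      forall v F F', F \in K -> F' \in K -> v \in F -> v \in F' ->
        connect (adjacent_triangles_at v) F F'
    & forall F F', F \in K -> F' \in K -> connect adjacent_triangles F F'].

End Triangulation.

Local Open Scope classical_set_scope.

(* Points of the geometric realization are given by barycentric coordinates. *)
Definition realization (R : realType) (N : nat) (K : {set {set 'I_N}}) :
    set 'rV[R]_N :=
  [set x : 'rV[R]_N | [/\ forall i, 0 <= x ord0 i, \sum_i x ord0 i = 1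
    & exists2 F, F \in K & forall i, x ord0 i != 0 -> i \in F]].

Definition locally_planar (R : realType) (S : topologicalType) : Prop :=
  forall p : S, exists (U : set S) (f : S -> 'rV[R]_2),
    [/\ open U, U p, {in U &, injective f},
        forall q, U q -> {for q, continuous f}
      & forall V, open V -> V `<=` U -> open (f @` V)].

Definition closed_surface (R : realType) (S : topologicalType) : Prop :=
  [/\ compact [set: S], connected [set: S], hausdorff_space S
    & locally_planar R S].

(* As [S] is compact, a continuous bijection onto the realization is a
   homeomorphism. *)
Definition triangulates (R : realType) (N : nat) (K : {set {set 'I_N}})
    (S : topologicalType) : Prop :=
  closed_surface_complex K /\
  exists f : S -> 'rV[R]_N,
    [/\ continuous f, injective f & range f = realization K].

(* The Euler genus of a surface is 2 minus its Euler characteristic, which is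
   computed from any triangulation. *)
Definition surface_of_euler_genus (R : realType) (S : topologicalType)
    (k : nat) : Prop :=
  closed_surface R S /\
  exists (N : nat) (K : {set {set 'I_N}}),
    triangulates R K S /\ k%:Z = 2 - euler_char K.

(* A drawing without crossings: [phi] places the vertices, and the edge [E]
   is drawn as the simple arc [gamma E], parametrized by [0, 1]. *)
Definition drawing (R : realType) (T : finType) (e : rel T)
    (S : topologicalType) (phi : T -> S) (gamma : {set T} -> R -> S) : Prop :=
  [/\ injective phi,
      forall E, E \in edges e ->
        [/\ {within `[0, 1], continuous (gamma E)},
            {in `[0, 1]%R &, injective (gamma E)}
          & [set gamma E 0; gamma E 1] = phi @` [set` E]],
      forall E x (t : R), E \in edges e -> 0 < t < 1 -> gamma E t <> phi x
    & forall E E' (t t' : R), E \in edges e -> E' \in edges e -> E != E' ->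
        0 < t < 1 -> 0 < t' < 1 -> gamma E t <> gamma E' t'].

Definition drawable_in_genus (R : realType) (T : finType) (e : rel T)
    (k : nat) : Prop :=
  exists S : topologicalType, surface_of_euler_genus R S k /\
    exists (phi : T -> S) (gamma : {set T} -> R -> S), drawing e phi gamma.

Definition has_euler_genus (R : realType) (T : finType) (e : rel T)
    (g : nat) : Prop :=
  drawable_in_genus R e g /\
  forall k : nat, drawable_in_genus R e k -> (g <= k)%N.

(* Main.v *)
Require Import Defs.
From mathcomp Require Import all_boot all_order all_algebra.
From mathcomp Require Import zify ring lra.
From mathcomp Require Import reals sequences exp.

Set Implicit Arguments.
Unset Strict Implicit.
Unset Printing Implicit Defensive.

Import Order.TTheory GRing.Theory Num.Theory.

(** Let every growth step advance a clock by [1 / b], where [b] is the number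
    of boundary edges at that moment.  This is the mean waiting time in the
    continuous process in which every boundary edge is added at rate 1, that
    is, in first-passage percolation with exponential edge lengths; the two
    estimates below are the Chernoff bounds for that process, and the discrete
    clock satisfies them with the same constants.

    Put [t = 2 D + 4 ln n], [r] for the square root of [Delta], and let [L] be
    the least integer above [107 r t].  If the height exceeds [107 r t], then
    either the clock is beyond [t] when the tree spans the graph, or it is not
    and the tree contains a path of [L] edges that starts at [s].  For each
    event a potential is exhibited that dominates its indicator at the end and
    does not grow on average; its initial value then bounds the probability
    ([final_prob_le]).

    - The clock is late.  Fix for each vertex a shortest route to [s].  A
      vertex whose route enters the current tree after [k > 0] edges
      contributes [2 ^ k], and the sum of these contributions is multiplied by
      [exp ((th - t) / 2)] when the clock shows [th].  The initial value is at
      most [(2 / exp 1) ^ D / n <= 1 / n]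
      ([time_potential_step], [time_potential_seed]).
    - A given path of [L] edges appears in time.  As the tree is rooted at
      [s], the edges of the path enter it in order, one at a time, each with
      chance [1 / b] per step.  The initial value is
      [exp (lam t) / (1 + lam) ^ L], used with [1 + lam = 107 r]
      ([path_potential_step], [path_potential_seed]).

    It remains to count the paths of [L] edges.  On a surface of Euler genus
    [g] every vertex set [W] spans at most [3 |W| + 3 g] edges
    ([drawable_sparse]).  Removing vertices of degree at most 11 as long as
    possible therefore leaves a core of at most [g] vertices, and gives every
    vertex at most 11 later neighbours ([peeling]).  Give weight [r] to a step
    towards a later neighbour and [1 / r] to any other step; the steps out of
    a vertex then have total weight at most [12 r].  The weights of an edge in
    the two directions multiply to at least 1 if one end is a later neighbour
    of the other, and to [1 / Delta] otherwise, when both ends lie in the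
    core; so a path or its reversal has weight at least of
    order [r ^ - g], and there are at most [r ^ g (n + 1) (12 r) ^ L] paths
    ([path_count]).  The hypothesis on [g] says that [r ^ g] is at most
    [exp (18 r (D + ln n))], which the exponential decay in [L] absorbs
    ([numeric_bound]).

    The edge bound is derived from a drawing with arbitrary continuous arcs,
    without the Jordan curve theorem.  Move the drawing into the geometric
    realization of a triangulation [K] of the surface, and cut every arc into
    thirds.  The outer thirds at a vertex form a connected compact hub; hubs
    and middle thirds are disjoint from one another, except that a middle
    third meets the hubs of its two ends.  Subdivide each triangle of [K] into
    [m ^ 2] triangles.  The open stars of the new vertices are small, cover
    the surface, and meet only along edges of the subdivision
    ([realization_star], [star_adjacent]).  For large [m] the vertices whose
    stars meet a hub, or a middle third, thus form connected sets with the
    same disjointness, so the graph is a minor of the subdivision.  The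
    subdivision has the Euler characteristic of [K] ([euler_subdivision]), and
    for a minor of a cell complex the bound is Euler's inequality
    ([euler_inequality]) together with the fact that every region has at least
    three edges on its frontier ([contraction_sparse]). *)

(** * Components and cuts *)

Section Components.
Variables (T E : finType) (ends : E -> {set T}).
Implicit Types (X Y B : {set E}) (a b : E) (x y u v : T) (Q : {set T}).

(** Components are taken in a hypergraph: two points are linked when some edge
    of [X] contains both.  The same notion serves for vertices, with [ends a]
    the two ends of [a], and for faces, with [ends a] the two sides of [a]. *)
Definition linked X : rel T :=
  [rel x y | [exists a in X, (x \in ends a) && (y \in ends a)]].

Definition component X x : {set T} := [set y | connect (linked X) x y].

Definition components X : {set {set T}} := [set component X x | x : T].

Lemma linkedP X x y :
  reflect (exists2 a, a \in X & (x \in ends a) && (y \in ends a)) (linked X x y).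
Proof. exact: exists_inP. Qed.

Lemma linked_sym X : symmetric (linked X).
Proof. by move=> x y; apply: eq_existsb => a; rewrite [(x \in _) && _]andbC. Qed.

Lemma connect_linked_sym X : connect_sym (linked X).
Proof. exact/sym_connect_sym/linked_sym. Qed.

Lemma connect_linkedS X Y x y : X \subset Y ->
  connect (linked X) x y -> connect (linked Y) x y.
Proof.
move=> sXY; apply: connect_sub => u v /linkedP[a aX uv]; apply: connect1.
by apply/linkedP; exists a => //; apply: (subsetP sXY).
Qed.

Lemma component_eqP X x y :
  reflect (component X x = component X y) (connect (linked X) x y).
Proof.
apply: (iffP idP) => [xy|eqxy].
  by apply/setP=> z; rewrite !inE (same_connect (connect_linked_sym X) xy).
have: y \in component X y by rewrite inE connect0.
by rewrite -eqxy inE.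
Qed.

Definition coarsen Y Q : {set T} := \bigcup_(x in Q) component Y x.

Lemma coarsen_component X Y x : X \subset Y ->
  coarsen Y (component X x) = component Y x.
Proof.
move=> sXY; apply/setP=> z; apply/bigcupP/idP => [[y]|xz].
  by rewrite inE => /(connect_linkedS sXY)/component_eqP->.
by exists x => //; rewrite inE connect0.
Qed.

Lemma componentsE X Y : X \subset Y ->
  components Y = [set coarsen Y Q | Q in components X].
Proof.
move=> sXY; apply/setP=> Q.
apply/imsetP/imsetP => [[x _ ->]|[_ /imsetP[x _ ->] ->]].
  by exists (component X x); rewrite ?coarsen_component ?imset_f.
by exists x; rewrite ?coarsen_component.
Qed.

Lemma card_componentsS X Y : X \subset Y -> #|components Y| <= #|components X|.
Proof. by move=> sXY; rewrite (componentsE sXY) leq_imset_card. Qed.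

(** A walk that uses the new edge [a] can be cut at its first and last visit
    to the ends of [a]. *)
Lemma connect_setU1 a X x y u v : ends a = [set x; y] ->
  connect (linked (a |: X)) u v ->
  [|| connect (linked X) u v, connect (linked X) u x && connect (linked X) y v
    | connect (linked X) u y && connect (linked X) x v].
Proof.
move=> aE; have cs := connect_linked_sym X.
case/connectP=> p; elim: p u => [|w p IHp] u /=; first by move=> _ ->; rewrite connect0.
case/andP=> /linkedP[b]; rewrite !inE => /predU1P[->|bX].
  rewrite aE !inE => /andP[uE wE] pP vE; have := IHp _ pP vE.
  have [->|wy] := eqVneq w y.
    rewrite connect0 /=; case/orP: uE => /eqP->; rewrite connect0 /=.
      by case: (connect _ y v); rewrite ?orbT //= => /orP[/andP[]|->]; rewrite ?orbT.
    by case: (connect _ y v); rewrite ?orbT //= => /orP[/andP[]|->]; rewrite ?orbT.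
  have /eqP-> : w == x by case/orP: wE => // /eqP wy'; rewrite wy' eqxx in wy.
  rewrite connect0 /=; case/orP: uE => /eqP->; rewrite connect0 /=.
    by case: (connect _ x v); rewrite ?orbT //= => /orP[->|/andP[]]; rewrite ?orbT.
  by case: (connect _ x v); rewrite ?orbT //= => /orP[->|/andP[]]; rewrite ?orbT.
move=> uw pP vE; have uwc : connect (linked X) u w by apply/connect1/linkedP; exists b.
by rewrite !(same_connect cs uwc); apply: IHp.
Qed.

(** Adding an edge with two ends merges at most two components: away from the
    component of [y] the coarsening map is injective. *)
Lemma card_components_setU1 a X : #|ends a| = 2 ->
  #|components X| <= #|components (a |: X)|.+1.
Proof.
move/eqP/cards2P=> [x [y [_ aE]]].
have sX : X \subset a |: X by apply/subsetP=> b; rewrite !inE orbC => ->.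
rewrite (cardsD1 (component X y)) -[#|components (a |: X)|.+1]add1n.
apply: leq_add; first by case: (_ \in _).
rewrite (componentsE sX) -(card_in_imset (f := coarsen (a |: X))).
  by apply/subset_leq_card/imsetS/subsetDl.
move=> P Q /setD1P[uy /imsetP[u _ uE]] /setD1P[vy /imsetP[v _ vE]]; subst P Q.
rewrite !(coarsen_component _ sX) => /component_eqP /(connect_setU1 aE).
have cs := connect_linked_sym X.
case/or3P=> [/component_eqP //|/andP[_]|/andP[]].
  by rewrite cs => /component_eqP yv; rewrite yv eqxx in vy.
by move=> /component_eqP yv; rewrite yv eqxx in uy.
Qed.

Lemma card_components_connected a X x y : ends a = [set x; y] ->
  connect (linked X) x y -> #|components (a |: X)| = #|components X|.
Proof.
move=> aE xy; have cs := connect_linked_sym X; apply: eq_card.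
have sX : X \subset a |: X by apply/subsetP=> b; rewrite !inE orbC => ->.
suff cE u : component (a |: X) u = component X u.
  by move=> Q; rewrite /components (eq_imset _ cE).
apply/setP=> v; rewrite !inE; apply/idP/idP; last exact: connect_linkedS.
case/(connect_setU1 aE)/or3P=> // /andP[uw wv].
  by apply: connect_trans uw (connect_trans xy wv).
by apply: connect_trans uw (connect_trans _ wv); rewrite cs.
Qed.

Lemma card_components0 : #|components set0| = #|T|.
Proof.
rewrite card_imset ?cardsT // => x y /component_eqP/connectP[[|z p]] /=; first by [].
by case/andP=> /linkedP[a]; rewrite inE.
Qed.

(** Each edge lowers the number of components by at most one. *)
Lemma card_forest X : (forall a, #|ends a| = 2) -> #|T| <= #|X| + #|components X|.
Proof.
move=> e2; rewrite -card_components0.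
elim: {X}#|X| {-2}X (erefl #|X|) => [|k IHk] X cX.
  by move/eqP: cX; rewrite cards_eq0 => /eqP->; rewrite leq_addl.
have [a aX] : exists a, a \in X by apply/card_gt0P; rewrite cX.
have cXa : #|X :\ a| = k by move: cX; rewrite (cardsD1 a) aX => -[].
rewrite (leq_trans (IHk _ cXa)) // cXa cX addSnnS leq_add2l.
by rewrite -{2}(setD1K aX); apply: card_components_setU1.
Qed.

Hypothesis ends2 : forall a, #|ends a| = 2.

(** [B] is a mod 2 cycle when [even_at B x] holds at every [x]. *)
Definition even_at B x := ~~ odd #|[set a in B | x \in ends a]|.

(** A mod 2 cycle crosses every cut an even number of times: sum the degrees
    over [Q]; an edge inside [Q] is counted twice. *)
Lemma even_cut B Q : (forall x, even_at B x) ->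
  ~~ odd #|[set a in B | #|ends a :&: Q| == 1]|.
Proof.
move=> evB.
have: ~~ odd (\sum_(x in Q) #|[set a in B | x \in ends a]|).
  elim/big_ind: _ => [//|m n|x _]; last exact: evB.
  by rewrite oddD => /negbTE-> /negbTE->.
have -> : \sum_(x in Q) #|[set a in B | x \in ends a]| = \sum_(a in B) #|ends a :&: Q|.
  under eq_bigr => x _ do rewrite -sum1dep_card.
  rewrite (exchange_big_dep (mem B)) /=; last by move=> x a _ /andP[].
  apply: eq_bigr => a aB; rewrite -sum1_card; apply: eq_bigl => x.
  by rewrite !inE aB andbC.
suff -> : odd (\sum_(a in B) #|ends a :&: Q|) = odd #|[set a in B | #|ends a :&: Q| ==
  1]| by [].
rewrite -sum1dep_card big_mkcondr /=.
elim/big_rec2: _ => // a m n _; rewrite !oddD => ->; congr (_ (+) _).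
have := subset_leq_card (subsetIl (ends a) Q); rewrite ends2.
by case: #|_| => [|[|[|]]].
Qed.

(** Otherwise [a] would be the only edge of the cycle that leaves the
    component of [x]. *)
Lemma even_not_bridge a X B x y : ends a = [set x; y] ->
  (forall x, even_at B x) -> a \in B -> B \subset a |: X -> connect (linked X) x y.
Proof.
move=> aE evB aB /subsetP sB; apply: contraT => nxy.
have := even_cut (component X x) evB.
suff -> : [set b in B | #|ends b :&: component X x| == 1] = [set a] by rewrite cards1.
apply/setP=> b; rewrite !inE; apply/andP/eqP => [[bB]|->]; last first.
  split=> //; suff -> : ends a :&: component X x = [set x] by rewrite cards1.
  apply/setP=> z; rewrite aE !inE andb_orl; have [->|zx] := eqVneq z x.
    by rewrite connect0.
  by case: eqP => [->|//]; rewrite (negbTE nxy).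
have := sB b bB; rewrite !inE => /predU1P[//|bX].
have /eqP/cards2P[u [v [uv bE]]] := ends2 b.
have uvc : connect (linked X) x u = connect (linked X) x v.
  rewrite ![connect _ x _](connect_linked_sym X).
  apply/same_connect/connect1/linkedP; first exact: connect_linked_sym.
  by exists b => //; rewrite bE !inE !eqxx orbT.
case xu: (connect (linked X) x u).
  suff -> : ends b :&: component X x = ends b by rewrite ends2.
  by apply/setIidPl/subsetP=> z; rewrite bE !inE => /orP[]/eqP->; rewrite -?uvc.
suff -> : ends b :&: component X x = set0 by rewrite cards0.
by apply/setP=> z; rewrite bE !inE; case: eqP => [->|_] /=;
  [rewrite xu|case: eqP => [->|//]; rewrite -uvc].
Qed.

End Components.

(** * Minors of cell complexes *)

Section EulerInequality.
Variables (VV EE FF : finType) (ends : EE -> {set VV}) (sides : EE -> {set FF}).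
Hypothesis ends2 : forall a, #|ends a| = 2.
Hypothesis sides2 : forall a, #|sides a| = 2.
Hypothesis boundary_even : forall f x,
  ~~ odd #|[set a | (x \in ends a) && (f \in sides a)]|.
Hypothesis vertices_connected : forall x y, connect (linked ends setT) x y.
Implicit Types (H : {set EE}) (Q : {set FF}) (a : EE).

(** The regions of the complement of the graph [H]: faces are joined across
    the edges that do not belong to [H]. *)
Definition regions H := components sides (~: H).

Definition frontier Q := [set a | #|sides a :&: Q| == 1].

(** The frontier is the mod 2 boundary of the chain [Q], hence a cycle; this
    is [even_cut] in the dual graph, applied to the edges at [x]. *)
Lemma frontier_even Q x : even_at ends (frontier Q) x.
Proof.
have ev f : even_at sides [set a | x \in ends a] f.
  rewrite /even_at.
  suff -> : [set b in [set a | x \in ends a] | f \in sides b] =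
            [set a | (x \in ends a) && (f \in sides a)] by apply: boundary_even.
  by apply/setP=> a; rewrite !inE.
suff -> : even_at ends (frontier Q) x =
    ~~ odd #|[set b in [set a | x \in ends a] | #|sides b :&: Q| == 1]|.
  exact: even_cut.
by congr (~~ odd _); apply: eq_card => a; rewrite !inE andbC.
Qed.

Lemma frontier_component H f : frontier (component sides (~: H) f) \subset H.
Proof.
apply/subsetP=> a; rewrite inE; apply: contraTT => aH.
have /eqP/cards2P[f1 [f2 [f12 aE]]] := sides2 a.
have f1f2 : connect (linked sides (~: H)) f f1 = connect (linked sides (~: H)) f f2.
  rewrite ![connect _ f _](connect_linked_sym sides).
  apply/same_connect/connect1/linkedP; first exact: connect_linked_sym.
  by exists a; rewrite ?inE // aE !inE !eqxx orbT.
case ff: (connect (linked sides (~: H)) f f1).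
  suff -> : sides a :&: component sides (~: H) f = sides a by rewrite sides2.
  by apply/setIidPl/subsetP=> z; rewrite aE !inE => /orP[]/eqP->; rewrite -?f1f2.
suff -> : sides a :&: component sides (~: H) f = set0 by rewrite cards0.
apply/setP=> z; rewrite aE !inE; case: eqP => [->|_] /=; first by rewrite ff.
by case: eqP => [->|//]; rewrite -f1f2.
Qed.

(** Delete the edges one at a time, starting from the whole complex.  If the
    two sides of the deleted edge belong to one region, the regions do not
    change, and the number of components grows by at most one.  If two regions
    merge, the deleted edge lies on the frontier of one of them, so it is not
    a bridge, and the number of components does not change. *)
Lemma euler_inequality H :
  #|FF| + #|H| + #|components ends H| <= #|regions H| + #|EE|.+1.
Proof.
elim: {H}#|~: H| {-2}H (erefl #|~: H|) => [|k IHk] H cH.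
  have HT : H = setT by move/eqP: cH; rewrite cards_eq0 => /eqP/(congr1 (@setC _));
    rewrite setCK setC0.
  rewrite /regions {H cH}HT setCT card_components0 // cardsT addnS -addnA -addn1 !addnA
    leq_add2l.
  have [x _|VV0] := pickP (@predT VV); last first.
    rewrite (leq_trans (card_componentsS ends (sub0set _))) //.
    by rewrite card_components0 // eq_card0.
  rewrite -(cards1 (component ends setT x));
    apply/subset_leq_card/subsetP=> _ /imsetP[y _ ->].
  by rewrite inE; apply/eqP/component_eqP.
have [a aH] : exists a, a \in ~: H by apply/card_gt0P; rewrite cH.
have HE : ~: H = a |: ~: (a |: H).
  apply/setP=> b; rewrite !inE negb_or; case: eqP => [->|//] /=.
  by rewrite inE in aH.
have cHa : #|~: (a |: H)| = k.
  move: cH; rewrite HE cardsU1 !inE eqxx /= => -[]//.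
have := IHk _ cHa; rewrite cardsU1; rewrite inE in aH; rewrite aH.
rewrite add1n /regions HE => IH.
have /eqP/cards2P[f1 [f2 [f12 saE]]] := sides2 a.
have [f1f2|f1f2] := boolP (connect (linked sides (~: (a |: H))) f1 f2).
  rewrite (card_components_connected saE f1f2).
  apply: leq_trans IH; rewrite addnS addSn -addnS leq_add2l.
  exact: card_components_setU1.
have /eqP/cards2P[x [y [xy eaE]]] := ends2 a.
have xyH : connect (linked ends H) x y.
  apply: (even_not_bridge ends2 eaE (frontier_even (component sides (~: (a |: H)) f1)) _ _).
    rewrite inE saE; suff -> : [set f1; f2] :&: component sides (~: (a |: H)) f1 = [set f1].
      by rewrite cards1.
    apply/setP=> z; rewrite !inE andb_orl; have [->|zx] := eqVneq z f1.
      by rewrite connect0.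
    by case: eqP => [->|//]; rewrite (negbTE f1f2).
  exact: frontier_component.
rewrite (card_components_connected eaE xyH) in IH.
have := @card_components_setU1 _ _ sides a (~: (a |: H)) (sides2 a).
rewrite -(leq_add2r #|EE|.+1); rewrite addSn => /(leq_trans IH).
by rewrite addnS !addSn ltnS.
Qed.

End EulerInequality.

Definition rel_on (T : finType) (r : rel T) (A : {set T}) : rel T :=
  [rel x y | [&& x \in A, y \in A & r x y]].

Lemma rel_onS (T : finType) (r : rel T) (A A' : {set T}) x y : A \subset A' ->
  connect (rel_on r A) x y -> connect (rel_on r A') x y.
Proof.
move=> /subsetP sA; apply: connect_sub => u v /and3P[uA vA uv].
by apply/connect1/and3P; split=> //; apply: sA.
Qed.

Lemma connect_exit (T : finType) (r : rel T) (A : {set T}) x y :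
  x \in A -> y \notin A -> connect r x y ->
  exists u v, [/\ u \in A, v \notin A & r u v].
Proof.
move=> xA yA /connectP[p]; elim: p x xA => [|z p IHp] x xA /=.
  by move=> _ yx; rewrite yx xA in yA.
case/andP=> xz pP yE; have [zA|zA] := boolP (z \in A); first exact: IHp pP yE.
by exists x, z.
Qed.

Section Minor.
Variables (VV EE FF : finType) (ends : EE -> {set VV}) (sides : EE -> {set FF}).
Hypothesis ends2 : forall a, #|ends a| = 2.
Hypothesis sides2 : forall a, #|sides a| = 2.
Hypothesis boundary_even : forall f x,
  ~~ odd #|[set a | (x \in ends a) && (f \in sides a)]|.
Hypothesis vertices_connected : forall x y, connect (linked ends setT) x y.
Hypothesis faces_connected : forall f f', connect (linked sides setT) f f'.

Local Notation adj := (linked ends setT).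

Lemma linked_ends x y : adj x y -> x != y -> exists a, ends a = [set x; y].
Proof.
case/linkedP=> a _ /andP[xa ya] xy; exists a; apply/esym/eqP.
by rewrite eqEcard ends2 cards2 xy subUset !sub1set xa ya.
Qed.

Variables (V E : finType) (src tgt : E -> V).
Hypothesis loopless : forall e, src e != tgt e.
Hypothesis simple : injective (fun e => [set src e; tgt e]).

Section Contraction.
Variables (B : V -> {set VV}) (link : E -> EE).
Hypothesis B_nonempty : forall v, B v != set0.
Hypothesis B_disjoint : forall v w x, x \in B v -> x \in B w -> v = w.
Hypothesis B_connected : forall v x y, x \in B v -> y \in B v ->
  connect (rel_on adj (B v)) x y.
Hypothesis linkP : forall e, exists x y,
  [/\ ends (link e) = [set x; y], x \in B (src e) & y \in B (tgt e)].

(** The edges inside the branch sets; a minimal subset of them with the same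
    connectivity is a spanning forest of the branch sets. *)
Let inner : {set EE} := [set a | [exists v, ends a \subset B v]].

Let spanning (X : {set EE}) := [&& X \subset inner &
  [forall x, forall y, connect (linked ends inner) x y ==> connect (linked ends X) x y]].

Lemma link_meet e v : #|ends (link e) :&: B v| = (v \in [set src e; tgt e]).
Proof.
have [x [y [eE xB yB]]] := linkP e; rewrite eE !inE.
have nxy : x != y.
  by apply: contraNneq (loopless e) => xy; apply/eqP/(B_disjoint xB); rewrite xy.
have [->|vs] := eqVneq v (src e).
  suff -> : [set x; y] :&: B (src e) = [set x] by rewrite cards1.
  apply/setP=> z; rewrite !inE andb_orl; case: eqP => [->|_]; first by rewrite xB.
  case: eqP => [->|//] /=; apply/negP=> yB'; move/eqP: (loopless e); apply.
  exact: B_disjoint yB' yB.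
have [->|vt] := eqVneq v (tgt e).
  suff -> : [set x; y] :&: B (tgt e) = [set y] by rewrite cards1.
  apply/setP=> z; rewrite !inE andb_orl; case: (z =P y) => [->|_]; first by rewrite yB orbT.
  rewrite orbF; case: eqP => [->|//] /=; apply/negP=> xB'; move/eqP: (loopless e); apply.
  exact: B_disjoint xB xB'.
suff -> : [set x; y] :&: B v = set0 by rewrite cards0.
apply/setP=> z; rewrite !inE; apply/negP=> /andP[/orP[]/eqP-> zB].
  by move/eqP: vs; apply; apply: B_disjoint zB xB.
by move/eqP: vt; apply; apply: B_disjoint zB yB.
Qed.

Lemma inner_meet a v : a \in inner -> #|ends a :&: B v| != 1.
Proof.
rewrite inE => /existsP[w /subsetP aw].
have [->|/set0Pn[x /setIP[/aw xw xv]]] := eqVneq (ends a :&: B v) set0.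
  by rewrite cards0.
suff -> : ends a :&: B v = ends a by rewrite ends2.
by apply/setIidPl/subsetP=> z /aw; rewrite (B_disjoint xv xw).
Qed.

Lemma link_inj : injective link.
Proof.
move=> e e' ee'; apply: simple; apply/setP=> v.
by apply/idP/idP => ve; apply: contraT => ve';
   have := link_meet e v; rewrite ee' link_meet ve (negbTE ve').
Qed.

Lemma link_notin_inner e : link e \notin inner.
Proof. by apply/negP=> /(inner_meet (src e)); rewrite link_meet !inE eqxx. Qed.

(** Take for [H] a spanning forest of the branch sets together with one edge
    of the complex for each edge of the minor.  Euler's inequality bounds the
    number of regions of [H] from below.  Unless there is a single region, the
    frontier of each region contains at least three of the added edges: it is
    a nonempty cycle, so it is not contained in the forest, and at each end of
    an added edge it contains a second one; these two differ as the minor is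
    simple.  Each added edge lies on at most two frontiers. *)
Lemma contraction_sparse g : #|VV| + #|FF| + g = #|EE| + 2 ->
  #|E| <= 3 * #|V| + 3 * g.
Proof.
move=> chi.
have [Fo /minsetP[/andP[FoI /forallP FoC] Fomin]] : {X | minset spanning X}.
  apply: ex_minset; exists inner; rewrite /spanning subxx.
  by apply/forallP=> x; apply/forallP=> y; apply/implyP.
have FoP x y : connect (linked ends inner) x y -> connect (linked ends Fo) x y.
  by move: (FoC x) => /forallP/(_ y)/implyP.
(* By minimality, every edge of [Fo] is a bridge of [Fo]. *)
have acyclic (Z : {set EE}) : Z \subset Fo -> (forall x, even_at ends Z x) -> Z = set0.
  move=> ZFo Zev; apply/eqP; apply: contraT => /set0Pn[a aZ].
  have aFo := subsetP ZFo _ aZ.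
  have /eqP/cards2P[x [y [xy aE]]] := ends2 a.
  have xyc : connect (linked ends (Fo :\ a)) x y.
    by apply: (even_not_bridge ends2 aE Zev aZ); rewrite setD1K.
  suff sp : spanning (Fo :\ a).
    by have := Fomin _ sp (subsetDl _ _) => /setP/(_ a); rewrite !inE eqxx aFo.
  apply/andP; split; first exact: subset_trans (subsetDl _ _) FoI.
  apply/forallP=> u; apply/forallP=> v; apply/implyP=> /FoP.
  rewrite -{1}(setD1K aFo) => /(connect_setU1 aE).
  have cs := connect_linked_sym ends (Fo :\ a).
  case/or3P=> // /andP[uw wv]; first exact: connect_trans uw (connect_trans xyc wv).
  by apply: connect_trans uw (connect_trans _ wv); rewrite cs.
pose H := Fo :|: [set link e | e : E].
have cardH : #|H| = #|Fo| + #|E|.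
  rewrite cardsU (_ : _ :&: _ = set0) ?cards0 ?subn0; last first.
    apply/setP=> a; rewrite !inE; apply/negP=> /andP[/(subsetP FoI) aI /imsetP[e _ ae]].
    by have := link_notin_inner e; rewrite -ae aI.
  by rewrite card_imset ?cardsT //; apply: link_inj.
pose O := ~: \bigcup_v B v.
have compFo : #|components ends Fo| <= #|O| + #|V|.
  have /fin_all_exists[r rP] v : exists x, x \in B v by apply/set0Pn.
  have cov : components ends Fo \subset
      [set component ends Fo x | x in O] :|: [set component ends Fo (r v) | v : V].
    apply/subsetP=> _ /imsetP[x _ ->]; rewrite inE.
    have [xO|] := boolP (x \in O); first by rewrite imset_f.
    rewrite inE negbK => /bigcupP[v _ xv]; apply/orP; right.
    apply/imsetP; exists v => //; apply/component_eqP/FoP.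
    apply: connect_sub (B_connected xv (rP v)) => y z /and3P[yv zv yz].
    have [->//|nyz] := eqVneq y z; have [a aE] := linked_ends yz nyz.
    apply/connect1/linkedP; exists a; last by rewrite aE !inE !eqxx orbT.
    by rewrite inE; apply/existsP; exists v; rewrite aE subUset !sub1set yv.
  apply: leq_trans (subset_leq_card cov) _; rewrite (leq_trans (leq_card_setU _ _)) //.
  by rewrite leq_add ?leq_imset_card.
have HB a x : a \in H -> x \in ends a -> x \notin O.
  rewrite !inE negbK => /orP[/(subsetP FoI)|/imsetP[e _ ->]].
    by rewrite inE => /existsP[v /subsetP av] /av xv; apply/bigcupP; exists v.
  have [y [z [-> yB zB]]] := linkP e.
  by rewrite !inE => /orP[]/eqP->; apply/bigcupP; [exists (src e)|exists (tgt e)].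
(* The vertices outside the branch sets are isolated in [H]. *)
have compH : #|O| <= #|components ends H|.
  rewrite -(card_imset _ (@set1_inj VV)); apply/subset_leq_card/subsetP.
  move=> _ /imsetP[x xO ->]; apply/imsetP; exists x => //.
  apply/setP=> y; rewrite !inE; apply/eqP/idP => [->|]; first exact: connect0.
  move=> xy; apply/eqP; apply: contraT => nyx.
  have [||u [v [/set1P-> _ /linkedP[a aH /andP[xa _]]]]] :=
    @connect_exit _ _ [set x] x y _ _ xy.
  - by rewrite inE.
  - by rewrite inE.
  by have := HB a x aH xa; rewrite xO.
have regionsH : 3 * #|regions sides H| <= 2 * #|E| + 3.
  have [le1|gt1] := leqP #|regions sides H| 1.
    by rewrite (leq_trans (leq_mul (leqnn 3) le1)) ?leq_addl.
  pose S (Q : {set FF}) := [set e | link e \in frontier sides Q].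
  (* [S Q] is the set of added edges on the frontier of [Q]. *)
  have S3 Q : Q \in regions sides H -> 3 <= #|S Q|.
    move=> /imsetP[f _ QE].
    have ZH : frontier sides Q \subset H by rewrite QE; apply: frontier_component.
    have Zev x : even_at ends (frontier sides Q) x by apply: frontier_even.
    have Z0 : frontier sides Q != set0.
      apply: contraL gt1 => /eqP Z0; rewrite -leqNgt.
      suff QT : Q = setT.
        rewrite -(cards1 Q); apply/subset_leq_card/subsetP=> _ /imsetP[f' _ ->].
        have: f' \in Q by rewrite QT inE.
        by rewrite inE QE inE connect_linked_sym => ff'; apply/eqP/component_eqP.
      apply/setP=> f'; rewrite inE; apply: contraT => f'Q.
      have fQ : f \in Q by rewrite QE inE connect0.
      have [u [v [uQ vQ /linkedP[a _ /andP[ua va]]]]] :=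
        connect_exit fQ f'Q (faces_connected f f').
      have uv : u != v by apply: contraNneq vQ => <-.
      have aE : sides a = [set u; v].
        by apply/esym/eqP; rewrite eqEcard sides2 cards2 uv subUset !sub1set ua va.
      have /setP/(_ a) := Z0; rewrite !inE aE => /negP; case.
      suff -> : [set u; v] :&: Q = [set u] by rewrite cards1.
      apply/setP=> z; rewrite !inE andb_orl; case: eqP => [->|_]; first by rewrite uQ.
      by case: eqP => [->|//]; rewrite (negbTE vQ).
    (* At the branch set [B v], the frontier leaves through added edges only. *)
    have Sev v : ~~ odd #|[set e in S Q | v \in [set src e; tgt e]]|.
      have := even_cut ends2 (B v) Zev; congr (~~ odd _).
      rewrite -(card_imset _ link_inj); apply: eq_card => a.
      apply/idP/imsetP => [/setIdP[aZ]|[e /setIdP[eS ve] ->]]; last first.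
        by apply/setIdP; rewrite link_meet ve; rewrite inE in eS.
      have := subsetP ZH a aZ; rewrite inE => /orP[/(subsetP FoI) aI|/imsetP[e _ aE]].
        by rewrite (negbTE (inner_meet v aI)).
      rewrite aE link_meet => ve; exists e => //; apply/setIdP.
      by split; [rewrite inE -aE|move: ve; case: (v \in _)].
    have other v e : e \in S Q -> v \in [set src e; tgt e] ->
        exists e', [/\ e' \in S Q, v \in [set src e'; tgt e'] & e' != e].
      move=> eS ve; have := Sev v; rewrite (cardsD1 e) [e \in _]inE eS ve /=.
      set others := _ :\ e.
      have [->|/set0Pn[e' /setD1P[ne]]] := eqVneq others set0.
        by rewrite cards0.
      by rewrite inE => /andP[e'S ve'] _; exists e'.
    have [e1 e1S] : exists e, e \in S Q.
      apply/set0Pn; apply: contra Z0 => /eqP S0; apply/eqP/acyclic => //.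
      apply/subsetP=> a aZ; have := subsetP ZH a aZ;
        rewrite inE => /orP[//|/imsetP[e _ aE]].
      by have /setP/(_ e) := S0; rewrite !inE -aE; rewrite inE in aZ; rewrite aZ.
    have [|e2 [e2S e2s e21]] := other (src e1) e1 e1S; first by rewrite !inE eqxx.
    have [|e3 [e3S e3t e31]] := other (tgt e1) e1 e1S; first by rewrite !inE eqxx orbT.
    have e32 : e3 != e2.
      apply: contraNneq e21 => e32; apply/eqP/simple/esym/eqP.
      rewrite eqEcard !cards2 !loopless andbT subUset !sub1set e2s.
      by rewrite -e32.
    rewrite (cardsD1 e1) (cardsD1 e2) (cardsD1 e3) !inE e21 e31 e32.
    by move: e1S e2S e3S; rewrite !inE => -> -> ->.
  have: \sum_(Q in regions sides H) 3 <= \sum_(Q in regions sides H) #|S Q|.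
    exact: leq_sum.
  rewrite sum_nat_const mulnC => /leq_trans-> //.
  apply: leq_trans (leq_addr _ _).
  under eq_bigr => Q _ do rewrite -sum1dep_card.
  rewrite (exchange_big_dep predT) //= mulnC -sum_nat_const.
  apply: leq_sum => e _; rewrite sum1dep_card -(sides2 (link e)).
  apply: leq_trans (leq_imset_card (component sides (~: H)) _).
  apply/subset_leq_card/subsetP=> _ /setIdP[/imsetP[f _ ->]].
  rewrite inE => /eqP fQ.
  have [u /setIP[us uf]] : exists u, u \in sides (link e) :&: component sides (~: H) f.
    by apply/card_gt0P; rewrite fQ.
  by apply/imsetP; exists u => //; apply/component_eqP; rewrite inE in uf.
have := euler_inequality ends2 sides2 boundary_even vertices_connected H.
have := card_forest Fo ends2.
rewrite cardH; lia.
Qed.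

End Contraction.
End Minor.

Lemma connect_inv (T : finType) (r : rel T) (C : T -> Prop) x y :
  C x -> (forall u v, C u -> r u v -> C v) -> connect r x y -> C y.
Proof.
move=> Cx step /connectP[p]; elim: p x Cx => [|z p IHp] x Cx /=; first by move=> _ ->.
by case/andP=> xz pP yE; apply: IHp pP yE; apply: step Cx xz.
Qed.

Section TouchingSets.
Variables (VV EE FF : finType) (ends : EE -> {set VV}) (sides : EE -> {set FF}).
Hypothesis ends2 : forall a, #|ends a| = 2.
Hypothesis sides2 : forall a, #|sides a| = 2.
Hypothesis boundary_even : forall f x,
  ~~ odd #|[set a | (x \in ends a) && (f \in sides a)]|.
Hypothesis vertices_connected : forall x y, connect (linked ends setT) x y.
Hypothesis faces_connected : forall f f', connect (linked sides setT) f f'.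
Local Notation adj := (linked ends setT).
Variables (V E : finType) (src tgt : E -> V).
Hypothesis loopless : forall e, src e != tgt e.
Hypothesis simple : injective (fun e => [set src e; tgt e]).
Variables (B : V -> {set VV}) (P : E -> {set VV}).
Hypothesis B_nonempty : forall v, B v != set0.
Hypothesis B_disjoint : forall v w x, x \in B v -> x \in B w -> v = w.
Hypothesis B_connected : forall v x y, x \in B v -> y \in B v ->
  connect (rel_on adj (B v)) x y.
Hypothesis P_disjoint : forall e e' x, x \in P e -> x \in P e' -> e = e'.
Hypothesis P_connected : forall e x y, x \in P e -> y \in P e ->
  connect (rel_on adj (P e)) x y.
Hypothesis P_src : forall e, exists2 x, x \in P e & x \in B (src e).
Hypothesis P_tgt : forall e, exists2 x, x \in P e & x \in B (tgt e).
Hypothesis PB : forall e v x, x \in P e -> x \in B v -> v \in [set src e; tgt e].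

(** The part of [P e] that can be reached from [B (src e)] without entering
    [B (tgt e)]; annexing it to [B (src e)] makes the two branch sets of [e]
    adjacent. *)
Let grow e := [set x in P e | (x \notin B (tgt e)) &&
  [exists y in B (src e), connect (rel_on adj (P e :\: B (tgt e))) y x]].

Let branch v := B v :|: \bigcup_(e | src e == v) grow e.

Lemma growE e x : x \in grow e ->
  [/\ x \in P e, x \notin B (tgt e) & exists2 y, y \in B (src e) &
    connect (rel_on adj (P e :\: B (tgt e))) y x].
Proof.
rewrite inE => /andP[xP /andP[xB /existsP[y /andP[yB yx]]]].
by split=> //; exists y.
Qed.

Lemma grow_connected e x y : y \in B (src e) ->
  connect (rel_on adj (P e :\: B (tgt e))) y x -> 
  connect (rel_on adj (branch (src e))) y x.
Proof.
move=> yB yx; have ybranch : y \in branch (src e) by rewrite inE yB.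
have growbranch z w : connect (rel_on adj (P e :\: B (tgt e))) y w ->
    rel_on adj (P e :\: B (tgt e)) z w -> w \in branch (src e).
  move=> yw /and3P[_ /setDP[wP wB] _]; rewrite inE; apply/orP; right.
  apply/bigcupP; exists e => //; rewrite inE wP wB /=.
  by apply/existsP; exists y; rewrite yB.
pose C z := [/\ connect (rel_on adj (P e :\: B (tgt e))) y z, z \in branch (src e) &
  connect (rel_on adj (branch (src e))) y z].
suff [] : C x by [].
apply: connect_inv yx => [|z w [yz zB yz'] zw]; first by split; rewrite ?connect0.
have yw := connect_trans yz (connect1 zw); have wB := growbranch _ _ yw zw.
split=> //; apply: connect_trans yz' (connect1 _).
by apply/and3P; split=> //; case/and3P: zw.
Qed.

Lemma adj_sym A : symmetric (rel_on adj A).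
Proof.
by move=> x y; rewrite /rel_on [RHS]/= [LHS]/= andbCA (linked_sym ends setT x y).
Qed.

Lemma rel_on_connect_sym A : connect_sym (rel_on adj A).
Proof. exact/sym_connect_sym/adj_sym. Qed.

Lemma branchP v x : x \in branch v ->
  x \in B v \/ exists2 e, src e = v & x \in grow e.
Proof.
rewrite inE => /orP[xB|/bigcupP[e /eqP ev xe]]; [by left|by right; exists e].
Qed.

Lemma branch_to_B v x : x \in branch v ->
  exists2 y, y \in B v & connect (rel_on adj (branch v)) y x.
Proof.
case/branchP=> [xB|[e <- /growE[_ _ [y yB yx]]]].
  by exists x; rewrite ?connect0.
by exists y => //; apply: grow_connected.
Qed.

Lemma branch_connected v x y : x \in branch v -> y \in branch v ->
  connect (rel_on adj (branch v)) x y.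
Proof.
move=> /branch_to_B[x' xB xx] /branch_to_B[y' yB yy].
apply: connect_trans (connect_trans _ yy); first by rewrite rel_on_connect_sym; exact: xx.
exact: rel_onS (subsetUl _ _) (B_connected xB yB).
Qed.

Lemma branch_disjoint v w x : x \in branch v -> x \in branch w -> v = w.
Proof.
have Bgrow u e : x \in B u -> x \in grow e -> u = src e.
  move=> xu /growE[xP xt _]; have := PB xP xu; rewrite !inE => /orP[/eqP//|/eqP ut].
  by rewrite -ut xu in xt.
case/branchP=> [xv|[e <- xe]]; case/branchP=> [xw|[e' <- xe']].
- exact: B_disjoint xv xw.
- exact: Bgrow xv xe'.
- exact/esym/(Bgrow _ _ xw xe).
by case/growE: xe => xe _ _; case/growE: xe' => xe' _ _; rewrite (P_disjoint xe xe').
Qed.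

Lemma branch_link e : exists a, exists x y,
  [/\ ends a = [set x; y], x \in branch (src e) & y \in branch (tgt e)].
Proof.
have [x0 x0P x0B] := P_src e; have [z0 z0P z0B] := P_tgt e.
have notB x : x \in B (src e) -> x \notin B (tgt e).
  by move=> xs; apply/negP=> xt; have := loopless e; rewrite (B_disjoint xs xt) eqxx.
have gx0 : x0 \in grow e.
  by rewrite inE x0P notB //=; apply/existsP; exists x0; rewrite x0B connect0.
have gz0 : z0 \notin grow e by apply/negP=> /growE[_]; rewrite z0B.
have [u [v [ug vg /and3P[uP vP uv]]]] := connect_exit gx0 gz0 (P_connected x0P z0P).
have nuv : u != v by apply: contraNneq vg => <-.
have [a aE] := linked_ends ends2 uv nuv; exists a, u, v; split=> //.
  by rewrite inE; apply/orP; right; apply/bigcupP; exists e.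
rewrite inE; apply/orP; left; apply: contraR vg => vB.
have [_ uB [y yB yu]] := growE ug; rewrite inE vP vB; apply/existsP; exists y.
by rewrite yB; apply: connect_trans yu (connect1 _); apply/and3P; split=> //; apply/setDP.
Qed.

(** The sets [B v] and [P e] model the vertices and the edges of a graph inside
    the complex, with [P e] meeting exactly the two sets [B v] at its ends.
    Annexing to each [B v] the nearer part of the outgoing [P e] turns this
    into a model whose branch sets are joined by single edges. *)
Theorem touching_sets_sparse g : #|VV| + #|FF| + g = #|EE| + 2 ->
  #|E| <= 3 * #|V| + 3 * g.
Proof.
have [link linkP] := fin_all_exists branch_link.
apply: (contraction_sparse ends2 sides2 boundary_even vertices_connected
  faces_connected loopless simple _ branch_disjoint branch_connected linkP) => v.
by have /set0Pn[x xv] := B_nonempty v; apply/set0Pn; exists x; rewrite inE xv.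
Qed.

End TouchingSets.

(** * The m-fold subdivision of a triangulation *)

Section LatticePoints.
Variables (N m : nat).
Implicit Types (i j k : 'I_N) (A : {set 'I_N}).

(** The point [a] stands for the point of the realization with barycentric
    coordinates [a i / m].  The bound [m.+3] leaves room for the mass [m + 2]
    that occurs in the encoding of triangles. *)
Definition lattice := {ffun 'I_N -> 'I_m.+3}.
Implicit Types a b : lattice.

Definition mass a : nat := \sum_i a i.
Definition supp a : {set 'I_N} := [set i | 0 < a i].
Definition incr a i : lattice := [ffun j => inord (a j + (j == i))].
Definition decr a i : lattice := [ffun j => inord (a j - (j == i))].

Lemma latticeP a b : (forall i, a i = b i :> nat) -> a = b.
Proof. by move=> ab; apply/ffunP=> i; apply/val_inj/ab. Qed.

Lemma leq_mass a i : a i <= mass a.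
Proof. by rewrite /mass (bigD1 i) //= leq_addr. Qed.

Lemma decrE a i j : decr a i j = a j - (j == i) :> nat.
Proof. by rewrite ffunE inordK // (leq_ltn_trans (leq_subr _ _)). Qed.

Lemma incrE a i j : mass a <= m.+1 -> incr a i j = a j + (j == i) :> nat.
Proof.
move=> am; rewrite ffunE inordK //; have := leq_mass a j.
by case: (j == i) => /=; lia.
Qed.

Lemma supp_incr a i : mass a <= m.+1 -> supp (incr a i) = i |: supp a.
Proof.
by move=> am; apply/setP=> j; rewrite !inE incrE //; case: (j == i) => /=; lia.
Qed.

Lemma supp_decr a i : supp (decr a i) \subset supp a.
Proof. by apply/subsetP=> j; rewrite !inE decrE; lia. Qed.

Lemma supp_decrP a i j : j != i -> (j \in supp (decr a i)) = (j \in supp a).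
Proof. by move=> /negbTE ji; rewrite !inE decrE ji subn0. Qed.

Lemma mass_incr a i : mass a <= m.+1 -> mass (incr a i) = (mass a).+1.
Proof.
move=> am; rewrite /mass; under eq_bigr => j _ do rewrite incrE //.
rewrite big_split /= (_ : \sum_(j < N) (j == i) = 1) ?addn1 //.
by rewrite (bigD1 i) //= eqxx big1 // => j /negbTE->.
Qed.

Lemma decrK a i : i \in supp a -> mass a <= m.+2 -> incr (decr a i) i = a.
Proof.
rewrite inE => ai am; apply: latticeP => j; rewrite ffunE inordK decrE.
  by case: eqP => [->|] /=; lia.
by have := ltn_ord (a j); case: eqP => [->|] /=; lia.
Qed.

Lemma incrK a i : mass a <= m.+1 -> decr (incr a i) i = a.
Proof. by move=> am; apply: latticeP => j; rewrite decrE incrE // addnK. Qed.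

Lemma mass_decr a i : i \in supp a -> mass a = (mass (decr a i)).+1.
Proof.
rewrite inE => ai; rewrite /mass (bigD1 i) //= [in RHS](bigD1 i) //= decrE eqxx.
rewrite (eq_bigr (fun j => decr a i j : nat)); first by lia.
by move=> j /negbTE ji; rewrite decrE ji subn0.
Qed.

Lemma decr_inj a i j : i \in supp a -> decr a i = decr a j -> i = j.
Proof.
rewrite inE => ai /(congr1 (fun b : lattice => b i : nat)).
by rewrite !decrE eqxx; case: eqP => //; lia.
Qed.

Definition exact_count A n := #|[set a | (supp a == A) && (mass a == n)]|.

(** Lower the coordinate [i] by one; it stays positive or vanishes. *)
Lemma exact_count_rec A i n : i \in A -> n <= m.+1 ->
  exact_count A n.+1 = exact_count A n + exact_count (A :\ i) n.
Proof.
move=> iA nm; rewrite /exact_count.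
rewrite -(card_in_imset (f := fun a => decr a i)); last first.
  move=> a b /setIdP[/eqP sa /eqP ta] /setIdP[/eqP sb /eqP tb] ab.
  by rewrite -[a](@decrK _ i) -1?[b](@decrK _ i) ?sa ?sb ?ta ?tb ?ab.
rewrite -cardsUI [X in _ + X](_ : _ = 0) ?addn0; last first.
  apply/eqP; rewrite cards_eq0; apply/eqP/setP=> a; rewrite !inE.
  apply/negP=> /andP[/andP[/eqP-> _] /andP[/eqP/setP/(_ i)]].
  by rewrite !inE iA eqxx.
apply: eq_card => b; apply/imsetP/idP => [[a /setIdP[/eqP sa /eqP ta] ->]|].
  have ia : i \in supp a by rewrite sa.
  have tb : mass (decr a i) = n by have := mass_decr ia; rewrite ta => -[].
  rewrite !inE tb eqxx !andbT; have [ib|ib] := boolP (i \in supp (decr a i)).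
    apply/orP; left; apply/eqP; rewrite -sa; apply/setP=> j.
    by have [->|ji] := eqVneq j i; rewrite ?ib ?ia ?supp_decrP.
  apply/orP; right; apply/eqP; rewrite -sa; apply/setP=> j; rewrite in_setD1.
  by have [->|ji] := eqVneq j i; rewrite ?(negbTE ib) ?supp_decrP.
rewrite inE => bP; exists (incr b i); last first.
  by rewrite incrK //; case/orP: bP => /setIdP[_ /eqP->].
have tb : mass b = n by case/orP: bP => /setIdP[_ /eqP].
rewrite inE mass_incr ?tb // eqxx andbT supp_incr ?tb //.
by case/orP: bP => /setIdP[/eqP-> _]; rewrite ?setD1K //; apply/eqP/setUidPr;
  rewrite sub1set.
Qed.

Lemma exact_count0 n : exact_count set0 n = (n == 0).
Proof.
rewrite /exact_count; have [->|n0] := eqVneq n 0; last first.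
  apply/eqP; rewrite cards_eq0; apply/eqP/setP=> a; rewrite !inE.
  apply/negP=> /andP[/eqP/setP a0 /eqP an]; move/eqP: n0; apply; rewrite -an.
  by rewrite /mass big1 // => i _; have := a0 i; rewrite !inE; lia.
pose z : lattice := [ffun=> ord0].
transitivity #|[set z]|; last by rewrite cards1.
apply: eq_card => a; rewrite !inE.
apply/idP/eqP => [/andP[/eqP/setP a0 _]|->].
  by apply: latticeP => i; have := a0 i; rewrite !inE ffunE /=; lia.
apply/andP; split; first by apply/eqP/setP=> i; rewrite !inE ffunE.
by rewrite /mass big1 // => i _; rewrite ffunE.
Qed.

Lemma exact_count_neq0 A i : i \in A -> exact_count A 0 = 0.
Proof.
move=> iA; apply/eqP; rewrite cards_eq0; apply/eqP/setP=> a; rewrite !inE.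
apply/negP=> /andP[/eqP sa /eqP ta]; move: iA; rewrite -sa inE => ai.
by have := leq_mass a i; lia.
Qed.

Lemma exact_count1 A n : #|A| = 1 -> 0 < n <= m.+2 -> exact_count A n = 1.
Proof.
move=> /eqP/cards1P[i ->]; elim: n => // n IHn nm.
rewrite (exact_count_rec (set11 i)) ?setDv ?exact_count0; last by lia.
by case: n IHn nm => [|n] IHn nm; [rewrite (exact_count_neq0 (set11 i))|rewrite IHn //;
  lia].
Qed.

Hypothesis m_gt0 : 0 < m.

Lemma exact_count2 A : #|A| = 2 -> exact_count A m.+1 = (exact_count A m).+1.
Proof.
move=> A2; have [i iA] : exists i, i \in A by apply/card_gt0P; rewrite A2.
have A1 : #|A :\ i| = 1 by move: A2; rewrite (cardsD1 i) iA => -[].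
by rewrite (exact_count_rec iA) // (exact_count1 A1) ?addn1 //; lia.
Qed.

(** Second differences of the number of compositions into three parts are 1;
    this makes the contribution of a triangle of the complex to the Euler
    characteristic independent of [m]. *)
Lemma exact_count3 A : #|A| = 3 ->
  exact_count A m + exact_count A m.+2 = (exact_count A m.+1).*2.+1.
Proof.
move=> A3; have [i iA] : exists i, i \in A by apply/card_gt0P; rewrite A3.
have A2 : #|A :\ i| = 2 by move: A3; rewrite (cardsD1 i) iA => -[].
by rewrite !(exact_count_rec iA) ?exact_count2 //; lia.
Qed.

End LatticePoints.

Lemma card_sub_set (T : finType) (P Q : pred T) :
  #|[set u : {x | P x} | Q (val u)]| = #|[set x | P x && Q x]|.
Proof.
rewrite -(card_imset _ val_inj); apply: eq_card => x; rewrite !inE.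
apply/imsetP/andP => [[u]|[Px Qx]]; first by rewrite inE => Qu ->; rewrite (valP u).
by exists (Sub x Px); rewrite ?inE ?SubK.
Qed.

Section Subdivision.
Variables (N m : nat) (K : {set {set 'I_N}}).
Hypothesis m_gt0 : 0 < m.
Hypothesis K3 : forall F, F \in K -> #|F| = 3.

Definition face (A : {set 'I_N}) := [exists F in K, A \subset F].

Hypothesis K2 : forall A : {set 'I_N}, #|A| = 2 -> face A ->
  #|[set F in K | A \subset F]| = 2.
Implicit Types (i j k : 'I_N) (A B F P : {set 'I_N}) (a b : lattice N m).

Definition is_vertex a := (mass a == m) && face (supp a).

(** The pair [(a, P)] with [P = [set i; j]] encodes the edge that joins
    [a - e_i] and [a - e_j]. *)
Definition is_edge (p : lattice N m * {set 'I_N}) :=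
  [&& mass p.1 == m.+1, face (supp p.1), #|p.2| == 2 & p.2 \subset supp p.1].

(** The triangles of the subdivision of a face [F] come in two orientations.
    The pair [(a, false)] encodes the downward triangle with corners [a - e_i]
    for [i] in [F], and [(a, true)] the upright one with corners
    [a - e_i - e_j] for distinct [i], [j] in [F]. *)
Definition is_triangle (f : lattice N m * bool) :=
  (mass f.1 == m.+1 + f.2) && (supp f.1 \in K).

Definition vertex := {a | is_vertex a}.
Definition edge := {p | is_edge p}.
Definition triangle := {f | is_triangle f}.

Definition end_of (p : lattice N m * {set 'I_N}) a := [exists i in p.2, a == decr p.1 i].
Definition side_of (p : lattice N m * {set 'I_N}) (f : lattice N m * bool) :=
  if f.2 then [exists k, (k \notin p.2) && (f.1 == incr p.1 k)] else f.1 == p.1.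

Definition ends (p : edge) : {set vertex} := [set v | end_of (val p) (val v)].
Definition sides (p : edge) : {set triangle} := [set f | side_of (val p) (val f)].

Lemma faceS A B : A \subset B -> face B -> face A.
Proof.
move=> AB /exists_inP[F FK BF]; apply/exists_inP; exists F => //.
exact: subset_trans AB BF.
Qed.

Lemma face_in A : A \in K -> face A.
Proof. by move=> AK; apply/exists_inP; exists A. Qed.

Lemma face_le3 A : face A -> #|A| <= 3.
Proof. by case/exists_inP=> F /K3 <- AF; apply: subset_leq_card. Qed.

Lemma face3 A : face A -> #|A| = 3 -> A \in K.
Proof.
case/exists_inP=> F FK AF A3; suff -> : A = F by [].
by apply/eqP; rewrite eqEcard AF A3 K3.
Qed.

Lemma is_vertex_decr p i : is_edge p -> i \in p.2 -> is_vertex (decr p.1 i).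
Proof.
case/and4P=> /eqP tp fp _ sP iP; have ip := subsetP sP _ iP.
have := mass_decr ip; rewrite tp => -[tE].
by rewrite /is_vertex -tE eqxx (faceS _ fp) ?supp_decr.
Qed.

Lemma ends2 p : #|ends p| = 2.
Proof.
rewrite (card_sub_set is_vertex (end_of (val p))).
have /and4P[/eqP tp fp cP sP] := valP p.
have /cards2P[i [j [ij PE]]] := cP.
have [iP jP] : i \in (val p).2 /\ j \in (val p).2 by rewrite PE !inE !eqxx orbT.
rewrite (_ : [set _ | _] = [set decr (val p).1 i; decr (val p).1 j]).
  rewrite cards2; suff -> : decr (val p).1 i != decr (val p).1 j by [].
  by apply: contraNneq ij => /(decr_inj (subsetP sP _ iP))->.
apply/setP=> a; rewrite !inE; apply/andP/orP => [[_ /exists_inP[k]]|[]/eqP->].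
- by rewrite PE !inE => /orP[]/eqP-> /eqP->; [left|right].
- by split; [apply: is_vertex_decr (valP p) iP|apply/exists_inP; exists i].
- by split; [apply: is_vertex_decr (valP p) jP|apply/exists_inP; exists j].
Qed.

(** An edge in the interior of a face [F] lies on one triangle of each
    orientation, both in [F].  An edge on a side [P] of [F] lies on one
    upright triangle in each of the two faces that contain [P]. *)
Lemma sides2 p : #|sides p| = 2.
Proof.
rewrite (card_sub_set is_triangle (side_of (val p))).
have /and4P[/eqP tp fp cP sP] := valP p;
  case: p tp fp cP sP => -[a P] _ /= ta fa /eqP P2 sP.
have inc k : k \notin P -> is_triangle (incr a k, true) = (k |: supp a \in K).
  by move=> kP; rewrite /is_triangle /= mass_incr ta // addn1 eqxx supp_incr ?ta.
have [aK|aK] := boolP (supp a \in K).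
  have [k sPE] : exists k, supp a :\: P = [set k].
    by apply/cards1P; rewrite cardsDS // K3 // P2.
  have /setDP[ka kP] : k \in supp a :\: P by rewrite sPE inE.
  rewrite (_ : [set _ | _] = [set (a, false); (incr a k, true)]);
    first by rewrite cards2 xpair_eqE andbF.
  apply/setP=> -[b [|]]; rewrite !inE /side_of /= !xpair_eqE ?andbT ?andbF ?orbF ?orFb.
    apply/andP/eqP => [[bt /existsP[l /andP[lP /eqP bE]]]|->]; last first.
      by rewrite inc // (setUidPr _) ?sub1set //; split=> //; apply/existsP; exists k;
        rewrite kP /=.
    rewrite bE; congr incr; apply/set1P; rewrite -sPE inE lP /=.
    move: bt; rewrite bE inc // => /K3; rewrite cardsU1 (K3 aK).
    by case: (l \in supp a).
  apply/andP/eqP => [[_ /eqP]//|->]; split=> //.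
  by rewrite /is_triangle /= ta addn0 eqxx.
have a3 : #|supp a| != 3 by apply: contraNneq aK => /(face3 fa).
have aP : supp a = P.
  apply/esym/eqP; rewrite eqEcard sP P2 /=.
  by have := face_le3 fa; case: #|_| a3 => [|[|[|[|]]]].
rewrite -(K2 P2 _) -?aP // aP.
have uk k F : k \notin P -> F = k |: P -> F :\: P = [set k].
  by move=> kP ->; apply/setP=> z; rewrite !inE; case: eqP => [->|_];
    rewrite ?kP // andbC; case: (z \in P).
rewrite -(card_in_imset (f := fun f : lattice N m * bool => supp f.1)); last first.
  move=> [b c] [b' c']; rewrite !inE /side_of /=.
  case: c; case: c' => //=.
  - case/andP=> _ /existsP[k /andP[kP /eqP->]];
    case/andP=> _ /existsP[k' /andP[kP' /eqP->]].
    rewrite !supp_incr ?ta // aP => kk; congr (incr _ _, _).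
    by apply: set1_inj; rewrite -(uk k _ kP erefl) kk (uk k' _ kP' erefl).
  - by move=> _ /andP[/andP[_]] /= + /eqP E; rewrite E (negbTE aK).
  - by move=> /andP[/andP[_]] /= + /eqP E; rewrite E (negbTE aK).
  - by case/andP=> _ /eqP-> /andP[_ /eqP->].
apply: eq_card => F; apply/imsetP/setIdP => [[[b c]]|[FK PF]].
  rewrite inE /side_of /= => /andP[/andP[_ /= bK]].
  case: c => [/existsP[k /andP[kP /eqP bE]]|/eqP bE] ->;
    last by rewrite bE (negbTE aK) in bK.
  by split=> //=; rewrite bE supp_incr ?ta // aP subsetUr.
have [k FPE] : exists k, F :\: P = [set k] by apply/cards1P; rewrite cardsDS // K3 // P2.
have /setDP[kF kP] : k \in F :\: P by rewrite FPE inE.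
have FE : F = k |: P by rewrite -FPE setUC -{1}(setID F P) (setIidPr PF).
exists (incr a k, true); last by rewrite /= supp_incr ?ta // aP.
rewrite inE inc // aP -FE FK /=; apply/existsP; exists k; by rewrite kP /=.
Qed.

Lemma is_edge_down a i j : is_triangle (a, false) -> i \in supp a -> j \in supp a ->
  i != j -> is_edge (a, [set i; j]).
Proof.
case/andP=> /= ta aK ia ja ij; rewrite addn0 in ta.
by rewrite /is_edge /= ta face_in // cards2 ij subUset !sub1set ia.
Qed.

Lemma is_edge_up a k : is_triangle (a, true) -> k \in supp a ->
  is_edge (decr a k, supp a :\ k).
Proof.
case/andP=> /= /eqP ta aK ka.
have := mass_decr ka; rewrite ta addn1 => -[tE].
rewrite /is_edge /= -tE eqxx (faceS (supp_decr a k)) ?face_in //=.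
have := K3 aK; rewrite (cardsD1 k) ka add1n => -[->] /=.
by apply/subsetP=> z /setD1P[zk za]; rewrite supp_decrP.
Qed.

(** A corner of a triangle lies on two of its three edges. *)
Lemma boundary_even f v : ~~ odd #|[set p | (v \in ends p) && (f \in sides p)]|.
Proof.
rewrite (_ : [set _ | _] = [set p : edge | end_of (val p) (val v) && side_of (val p) (val
  f)]);
  last by apply/setP=> p; rewrite !inE.
rewrite (card_sub_set is_edge (fun p => end_of p (val v) && side_of p (val f))).
case: v => a av /=; case: f => -[b c] bf /=.
set S := [set _ | _].
case: c bf @S => bf S.
  have bK : supp b \in K by case/andP: bf.
  have tb : mass b = m.+2 by move: bf => /andP[/eqP/= ->]; rewrite addn1.
  have SP p : p \in S -> exists k i, [/\ k \in supp b, i \in supp b, i != k,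
      p = (decr b k, supp b :\ k) & a = decr (decr b k) i].
    case: p => q P; rewrite inE /side_of /end_of /= => /and3P[pe].
    case/exists_inP=> i iP /eqP aE /existsP[k /andP[kP /eqP bE]].
    have /and4P[/eqP /= tq fq /eqP P2 sP] := pe.
    have qE : q = decr b k by rewrite bE incrK ?tq.
    have kb : k \in supp b by rewrite bE supp_incr ?tq // !inE eqxx.
    have sPb : P \subset supp b :\ k.
      apply/subsetP=> z zP; rewrite inE; apply/andP; split.
        by rewrite inE; apply: contraNneq kP => <-.
      by rewrite bE supp_incr ?tq // inE (subsetP sP) ?orbT.
    have PE : P = supp b :\ k.
      apply/eqP; rewrite eqEcard sPb P2.
      by have := K3 bK; rewrite (cardsD1 k) kb add1n => -[->].
    have /setD1P[ik ib] : i \in supp b :\ k by rewrite -PE.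
    by exists k, i; rewrite qE PE aE qE.
  have [S0|/set0Pn[p0 /SP[k [i [kb ib ik _ aE]]]]] := eqVneq S set0;
    first by rewrite S0 cards0.
  have comm : decr (decr b k) i = decr (decr b i) k.
    by apply: latticeP => z; rewrite !decrE -!subnDA addnC.
  suff -> : S = [set (decr b k, supp b :\ k); (decr b i, supp b :\ i)].
    rewrite cards2 (_ : _ != _ = true) //; apply/eqP=> -[/(decr_inj kb) ki].
    by rewrite ki eqxx in ik.
  have inS l l' : l \in supp b -> l' \in supp b -> l' != l -> a = decr (decr b l) l' ->
      (decr b l, supp b :\ l) \in S.
    move=> lb lb' ll aE'; rewrite inE is_edge_up //= /end_of /side_of /=; apply/andP; split.
      by apply/exists_inP; exists l'; [apply/setD1P|apply/eqP].
    by apply/existsP; exists l; rewrite !inE eqxx /= decrK ?tb.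
  apply/setP=> p; apply/idP/set2P => [/SP[k' [i' [kb' ib' ik' -> aE']]]|[]->].
  - suff [->|->] : k' = k \/ k' = i by [left|right].
    have [->|kk] := eqVneq k' k; first by left.
    have [->|ki] := eqVneq k' i; first by right.
    have := congr1 (fun q : lattice N m => q k' : nat) (esym aE').
    rewrite aE !decrE eqxx eq_sym (negbTE ik') (negbTE kk) (negbTE ki).
    have := kb'; rewrite inE; case: (nat_of_ord (b k')) => // q _.
    by rewrite !subn0 subSS subn0 => qS; case: (n_Sn q qS).
  - exact: inS aE.
  - by apply: (inS i k) => //; [rewrite eq_sym|rewrite -comm].
have bK : supp b \in K by case/andP: bf.
have tb : mass b = m.+1 by move: bf => /andP[/eqP/= ->]; rewrite addn0.
have SP p : p \in S -> [/\ p.1 = b, p.2 \subset supp b, #|p.2| = 2 &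
    exists2 i, i \in p.2 & a = decr b i].
  case: p => q P; rewrite inE /side_of /end_of /= => /and3P[pe + /eqP bE].
  rewrite -bE in pe *; case/exists_inP=> i iP /eqP aE.
  by have /and4P[_ _ /eqP P2 sP] := pe; split=> //; exists i.
have [S0|/set0Pn[p0 /SP[_ sp0 _ [i /(subsetP sp0) ib aE]]]] := eqVneq S set0;
  first by rewrite S0 cards0.
have /cards2P[j [k [jk bE]]] : #|supp b :\ i| == 2.
  by have := K3 bK; rewrite (cardsD1 i) ib add1n => -[->].
have /setD1P[ji jb] : j \in supp b :\ i by rewrite bE !inE eqxx.
have /setD1P[ki kb] : k \in supp b :\ i by rewrite bE !inE eqxx orbT.
suff -> : S = [set (b, [set i; j]); (b, [set i; k])].
  rewrite cards2 (_ : _ != _ = true) //; apply/eqP=> -[/setP/(_ j)].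
  by rewrite !inE eqxx orbT (negbTE ji) (negbTE jk).
have inS l : l \in supp b -> l != i -> (b, [set i; l]) \in S.
  move=> lb li; rewrite inE is_edge_down 1?eq_sym //= /end_of /side_of /= eqxx andbT.
  by apply/exists_inP; exists i; rewrite ?inE ?eqxx ?aE.
apply/setP=> p; apply/idP/set2P =>
  [/SP[p1 sp p2 [i' ip /(etrans (esym aE)) /(decr_inj ib) ii]]|[]->];
  last 2 first; try exact: inS.
rewrite -ii {i' ii} in ip; case: p p1 sp p2 ip => q P /= -> sP P2 iP.
have [l PE] : exists l, P :\ i = [set l] by apply/cards1P; have := cardsD1 i P;
  rewrite P2 iP add1n => -[<-].
have -> : P = [set i; l] by rewrite -(setD1K iP) PE.
have : l \in supp b :\ i.
  have /setD1P[li lP] : l \in P :\ i by rewrite PE inE.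
  by apply/setD1P; split; rewrite ?(subsetP sP).
by rewrite bE !inE => /orP[]/eqP->; [left|right].
Qed.

End Subdivision.

Section SubdivisionShape.
Variables (N m : nat) (K : {set {set 'I_N}}).
Hypothesis m_gt0 : 0 < m.
Hypothesis K3 : forall F, F \in K -> #|F| = 3.
Local Notation face := (face K).
Hypothesis Kconnected : forall F F', F \in K -> F' \in K ->
  connect [rel F F' : {set 'I_N} | [&& F \in K, F' \in K & #|F :&: F'| == 2]] F F'.
Implicit Types (i j k l : 'I_N) (A B F P : {set 'I_N}) (a b : lattice N m).

Local Notation vertex := (@vertex N m K).
Local Notation edge := (@edge N m K).
Local Notation triangle := (@triangle N m K).
Local Notation ends := (@ends N m K).
Local Notation sides := (@sides N m K).
Local Notation vlink := (linked ends setT).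
Local Notation flink := (linked sides setT).

Definition simplex_count d := #|[set A : {set 'I_N} | (#|A| == d) && face A]|.

Lemma card_vertex : #|{: vertex}| = \sum_(A | face A) exact_count m A m.
Proof.
rewrite card_sig -sum1_card (partition_big (@supp N m) face) /=; last by move=> a /andP[].
apply: eq_bigr => A fA; rewrite sum1dep_card; apply: eq_card => a.
rewrite !inE /is_vertex; case: (supp a =P A) => [->|_]; rewrite ?andbF ?andbT ?fA ?andbT //.
Qed.

Lemma card_edge : #|{: edge}| = \sum_(A | face A) exact_count m A m.+1 * 'C(#|A|, 2).
Proof.
rewrite card_sig -sum1_card (partition_big (fun p => @supp N m p.1) face) /=;
  last by move=> a /and4P[].
apply: eq_bigr => A fA; rewrite sum1dep_card -cards_draws -cardsX; apply: eq_card => -[a P].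
rewrite !inE /= /is_edge /=; case: (supp a =P A) => [->|_]; rewrite ?andbF ?andbT ?fA //=.
by congr (_ && _); rewrite andbC.
Qed.

Lemma card_triangle : #|{: triangle}| =
  \sum_(A | face A) (#|A| == 3) * (exact_count m A m.+1 + exact_count m A m.+2).
Proof.
rewrite card_sig -sum1_card (partition_big (fun p => @supp N m p.1) face) /=; last first.
  by move=> a /andP[_ aK]; apply: face_in.
apply: eq_bigr => A fA; rewrite sum1dep_card.
have [A3|A3] := eqVneq #|A| 3; last first.
  rewrite mul0n; apply/eqP; rewrite cards_eq0; apply/eqP/setP=> -[a c].
  rewrite !inE /is_triangle /=; apply/negP=> /andP[/andP[_ aK] /eqP aA].
  by move: A3; rewrite -aA K3 ?eqxx.
rewrite mul1n; set S0 := [set _ | _].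
rewrite (_ : S0 = setX [set a | (supp a == A) && (mass a == m.+1)] [set false]
  :|: setX [set a | (supp a == A) && (mass a == m.+2)] [set true]); last first.
  apply/setP=> -[a c]; rewrite /S0 !inE /is_triangle /=.
  case: (supp a =P A) => [->|_]; rewrite ?andbF // (face3 K3 fA A3) ?andbT //=.
  by case: c; rewrite ?andbF ?andbT ?addn1 ?addn0 ?orbF.
rewrite cardsU !cardsX !cards1 !muln1 (_ : _ :&: _ = set0) ?cards0 ?subn0 //.
by apply/setP=> -[a c]; rewrite !inE /=; case: c; rewrite ?andbF.
Qed.

Lemma simplex_countE d : simplex_count d = \sum_(A | face A) (#|A| == d).
Proof.
rewrite /simplex_count -sum1dep_card big_mkcondl /=; apply: eq_bigr => A _.
by case: eqP.
Qed.

(** Sort the cells by their support.  The simplex [A] of [K] then contributes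
    its own sign to the Euler characteristic of the subdivision. *)
Lemma euler_subdivision : #|{: vertex}| + #|{: triangle}| + simplex_count 2 =
  #|{: edge}| + simplex_count 1 + simplex_count 3.
Proof.
rewrite card_vertex card_edge card_triangle !simplex_countE -!big_split /=.
apply: eq_bigr => A fA; have := face_le3 K3 fA.
case cA: #|A| => [|[|[|[|//]]]] _ /=; rewrite ?mul0n ?mul1n ?addn0.
- move/eqP: cA; rewrite cards_eq0 => /eqP->; rewrite !exact_count0 //; by lia.
- by rewrite exact_count1 // ?bin_small; lia.
- by rewrite exact_count2 // binn; lia.
- by have := exact_count3 m_gt0 cA; rewrite (_ : 'C(3, 2) = 3) //; lia.
Qed.

Lemma vlinkI (v w : vertex) p : is_edge K p -> end_of p (val v) -> end_of p (val w) ->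
  vlink v w.
Proof.
move=> pe pv pw; apply/linkedP; exists (Sub p pe : edge); first by [].
by rewrite !inE SubK pv.
Qed.

Lemma flinkI (f f' : triangle) p : is_edge K p -> side_of p (val f) -> side_of p (val f') ->
  flink f f'.
Proof.
move=> pe pv pw; apply/linkedP; exists (Sub p pe : edge); first by [].
by rewrite !inE SubK pv.
Qed.

Lemma mass_supp_other a j : a j < mass a -> exists2 i, i \in supp a & i != j.
Proof.
move=> ja; have [i /andP[ia ij]|no] := pickP (fun i => (i \in supp a) && (i != j)).
  by exists i.
move: ja; rewrite /mass (bigD1 j) //= big1 ?addn0 ?ltnn // => i ij.
by have := no i; rewrite ij andbT inE; lia.
Qed.

(** Moving unit masses to the coordinate [j] follows edges, and ends at the
    corner [j] of the complex. *)
Lemma vertex_peak F (v : vertex) j : F \in K -> supp (val v) \subset F -> j \in F ->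
  exists2 u : vertex, connect vlink v u & val u j = m :> nat.
Proof.
move=> FK; have [n] := ubnP (m - val v j); elim: n v => // n IHn v;
  rewrite ltnS => vn vF jF.
have /andP[/eqP tv _] := valP v.
have [vj|vj] := leqP m (val v j).
  by exists v => //; apply/eqP; have := leq_mass (val v) j; rewrite eqn_leq vj tv => ->.
have [i iv ij] : exists2 i, i \in supp (val v) & i != j by apply: mass_supp_other;
  rewrite tv.
pose a := incr (val v) j.
have ta : mass a = m.+1 by rewrite /a mass_incr ?tv.
have sa : supp a = j |: supp (val v) by rewrite /a supp_incr ?tv.
have aF : face (supp a).
  by apply/exists_inP; exists F => //; rewrite sa subUset sub1set jF.
have pe : is_edge K (a, [set i; j]).
  by rewrite /is_edge /= ta eqxx aF cards2 ij subUset !sub1set sa !in_setU1 eqxx iv orbT.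
have wv : is_vertex K (decr a i) by apply: is_vertex_decr pe _; rewrite !inE eqxx.
pose w : vertex := Sub _ wv.
have wj : val w j = (val v j).+1 :> nat.
  by rewrite SubK decrE eq_sym (negbTE ij) subn0 incrE ?tv // eqxx addn1.
have [||u wu uj] := IHn w _ _ jF.
- by rewrite wj subnS; apply: leq_trans vn; rewrite ltn_predL subn_gt0.
- rewrite SubK (subset_trans (supp_decr a i)) // sa subUset sub1set jF //.
exists u => //; apply: connect_trans (connect1 _) wu; apply: vlinkI pe _ _.
  by apply/exists_inP; exists j; rewrite ?inE ?eqxx ?orbT //= /a incrK ?tv.
by apply/exists_inP; exists i; rewrite ?inE ?eqxx //= SubK.
Qed.

Lemma vertex_peak0 (v : vertex) i j : val v j = m :> nat -> i != j -> val v i = 0 :> nat.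
Proof.
move=> vj ij; have /andP[/eqP tw _] := valP v; move: tw.
by rewrite /mass (bigD1 j) //= vj (bigD1 i) //=; lia.
Qed.

Lemma vertex_peak_uniq (u v : vertex) j : val u j = m :> nat -> val v j = m :> nat -> u = v.
Proof.
move=> uj vj; apply/val_inj/latticeP => i; have [->|ij] := eqVneq i j;
  first by rewrite uj vj.
by rewrite (vertex_peak0 uj ij) (vertex_peak0 vj ij).
Qed.

(** Within one face all vertices are joined to a corner, and consecutive faces
    of a chain share a corner. *)
Lemma vertices_connected (v w : vertex) : connect vlink v w.
Proof.
have cs := connect_linked_sym ends setT.
have same F (x y : vertex) : F \in K -> supp (val x) \subset F -> supp (val y) \subset F ->
    connect vlink x y.
  move=> FK xF yF; have /card_gt0P[j jF] : 0 < #|F| by rewrite K3.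
  have [u xu uj] := vertex_peak FK xF jF; have [u' yu uj'] := vertex_peak FK yF jF.
  by apply: connect_trans xu _; rewrite cs (vertex_peak_uniq uj uj').
have /andP[_ /exists_inP[F FK vF]] := valP v.
have /andP[_ /exists_inP[F' FK' wF]] := valP w.
pose C (G : {set 'I_N}) := forall y : vertex, supp (val y) \subset G -> connect vlink v y.
suff: C F' by apply.
apply: (connect_inv (C := C) _ _ (Kconnected FK FK')) =>
  [y yF|G G' IH /and3P[GK GK' /eqP GG]].
  exact: same FK vF yF.
have /card_gt0P[j /setIP[jG jG']] : 0 < #|G :&: G'| by rewrite GG.
move=> y yG; have [u yu uj] := vertex_peak GK' yG jG'.
apply: (@connect_trans _ _ u); last by rewrite cs.
apply: IH; apply/subsetP=> i; rewrite inE; have [->//|ij] := eqVneq i j.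
by rewrite (vertex_peak0 uj ij).
Qed.

Lemma triangle_card (f : triangle) : #|supp (val f).1| = 3.
Proof. by have /andP[_ /K3] := valP f. Qed.

(** The two triangles share the edge [(a, supp a :\ k)]. *)
Lemma down_up (f f' : triangle) a k : val f = (a, false) -> k \in supp a ->
  val f' = (incr a k, true) -> flink f f'.
Proof.
move=> fE ka fE'; have /andP[] := valP f; rewrite fE /= addn0 => ta aK.
apply: (flinkI (p := (a, supp a :\ k))).
- rewrite /is_edge /= ta face_in // subsetDl andbT.
  by have := cardsD1 k (supp a); rewrite ka (K3 aK) add1n => -[<-].
- by rewrite fE /side_of /=.
by rewrite fE' /side_of /=; apply/existsP; exists k; rewrite !inE !eqxx.
Qed.

(** Passing through a downward triangle moves one unit of mass between two
    coordinates, so all mass but the two units required for the support can be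
    gathered at [l]. *)
Lemma triangle_peak (f : triangle) l : (val f).2 -> l \in supp (val f).1 ->
  exists f' : triangle, [/\ connect flink f f', (val f').2,
    supp (val f').1 = supp (val f).1 & (val f').1 l = m :> nat].
Proof.
have [n] := ubnP (m - (val f).1 l); elim: n f => // n IHn f; rewrite ltnS.
case fE: (val f) => [b [|]] //= bn _ lb.
have /andP[] := valP f; rewrite fE /= addn1 => /eqP tb bK.
have b3 := K3 bK.
have [bl|bl] := leqP m (b l).
  exists f; rewrite fE; split=> //=; apply/eqP; rewrite eqn_leq bl andbT.
  move: tb; rewrite /mass (bigD1 l) //=.
  have : #|supp b :\ l| = 2 by have := cardsD1 l (supp b); rewrite lb b3 add1n => -[<-].
  move/eqP/cards2P=> [i [j [ij /setP ijE]]].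
  have /setD1P[il] : i \in supp b :\ l by rewrite ijE !inE eqxx.
  have /setD1P[jl] : j \in supp b :\ l by rewrite ijE !inE eqxx orbT.
  rewrite !inE => jb ib; rewrite (bigD1 i) //= (bigD1 j) /=; last by rewrite jl eq_sym.
  lia.
have [k [kb kl bk]] : exists k, [/\ k \in supp b, k != l & 1 < b k].
  have [k /and3P[k1 k2 k3]|no] := pickP (fun k => [&& k \in supp b, k != l & 1 < b k]).
    by exists k.
  move: tb; rewrite /mass (bigD1 l) //=.
  suff : \sum_(i < N | i != l) b i <= #|supp b :\ l|.
    have := cardsD1 l (supp b); rewrite lb b3 add1n => -[<-] le2 sumE.
    by have := leq_add bl le2; rewrite addSn sumE addn2 ltnn.
  rewrite -[leqRHS]sum1_card [leqLHS](bigID (fun i =>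
    i \in supp b)) /= [X in _ + X]big1 ?addn0; last first.
    by move=> i /andP[_]; rewrite inE -eqn0Ngt => /eqP.
  rewrite [leqRHS](eq_bigl (fun i => (i != l) && (i \in supp b))); last by move=> i;
    rewrite !inE.
  by apply: leq_sum => i /andP[il ib]; have := no i; rewrite ib il /=; lia.
have td := mass_decr kb; rewrite tb in td; case: td => td.
have sd : supp (decr b k) = supp b.
  apply/eqP; rewrite eqEsubset supp_decr; apply/subsetP=> i.
  by rewrite !inE decrE; case: eqP => [->|]; lia.
have dt : is_triangle K (decr b k, false) by rewrite /is_triangle /= -td addn0 eqxx sd.
have ut : is_triangle K (incr (decr b k) l, true).
  by rewrite /is_triangle /= mass_incr -td ?addn1 ?eqxx // supp_incr -?td // sd (setUidPr
    _) ?sub1set.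
pose d : triangle := Sub _ dt; pose u : triangle := Sub _ ut.
have [|||f' [uf' c' sf' lf']] := IHn u.
- rewrite SubK /= incrE -?td // decrE eqxx eq_sym (negbTE kl); lia.
- by rewrite SubK.
- by rewrite SubK /= supp_incr -?td // sd !in_setU1 lb orbT.
exists f'; split=> //; last first.
  by rewrite sf' SubK /= supp_incr -?td // sd (setUidPr _) ?sub1set ?fE.
apply: connect_trans uf'; apply: (@connect_trans _ _ d).
  rewrite (connect_linked_sym sides); apply/connect1/(@down_up _ _ (decr b k) k);
    rewrite ?SubK //.
    by rewrite sd.
  by rewrite decrK ?tb.
by apply/connect1/(@down_up _ _ (decr b k) l); rewrite ?SubK ?sd.
Qed.

Lemma triangle_peak_uniq (f f' : triangle) l : (val f).2 -> (val f').2 ->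
  supp (val f).1 = supp (val f').1 -> (val f).1 l = m :> nat ->
    (val f').1 l = m :> nat -> f = f'.
Proof.
have ex (h : triangle) i : (val h).2 -> (val h).1 l = m :> nat -> i != l ->
    (val h).1 i = (i \in supp (val h).1) :> nat.
  have /andP[/eqP th hK] := valP h; case: (val h) th hK => b [|] //= th hK _ hl il.
  case ib: (i \in supp b); last by move: ib; rewrite inE /=; lia.
  have lb : l \in supp b by rewrite inE hl.
  have : #|supp b :\ l| = 2 by have := cardsD1 l (supp b);
    rewrite lb (K3 hK) add1n => -[<-].
  rewrite (cardsD1 i) in_setD1 il ib /= add1n => -[/eqP/cards1P[j jE]].
  have : j \in (supp b :\ l) :\ i by rewrite jE inE.
  rewrite !inE => /and3P[ji jl jb]; rewrite inE in ib.
  move: th; rewrite /mass (bigD1 l) //= (bigD1 i) //= (bigD1 j) /=; last by rewrite jl.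
  by rewrite hl; lia.
move=> c c' sf fl fl'; apply: val_inj.
have E1 : (val f).1 = (val f').1.
  apply: latticeP => i; have [->|il] := eqVneq i l; first by rewrite fl fl'.
  by rewrite (ex _ _ c fl il) (ex _ _ c' fl' il) sf.
by case: (val f) (val f') E1 c c' => [b d] [b' d'] /= -> -> ->.
Qed.

(** Within one face all triangles are joined to the triangle at a corner;
    adjacent faces of [K] are joined across any edge of the subdivision that
    lies on their common side. *)
Lemma triangles_connected (f f' : triangle) : connect flink f f'.
Proof.
have cs := connect_linked_sym sides setT.
have up (h : triangle) : exists2 h' : triangle, connect flink h h' &
    (val h').2 /\ supp (val h').1 = supp (val h).1.
  case hE: (val h) => [b [|]]; first by exists h; rewrite ?hE.
  have /andP[] := valP h; rewrite hE /= addn0 => /eqP tb bK.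
  have /card_gt0P[k kb] : 0 < #|supp b| by rewrite K3.
  have ut : is_triangle K (incr b k, true).
    by rewrite /is_triangle /= mass_incr tb ?addn1 ?eqxx // supp_incr ?tb // (setUidPr _)
      ?sub1set.
  exists (Sub _ ut : triangle).
    by apply/connect1/(down_up hE kb); rewrite SubK.
  by rewrite SubK /= supp_incr ?tb // (setUidPr _) ?sub1set.
have same (g h : triangle) : supp (val g).1 = supp (val h).1 -> connect flink g h.
  move=> gh; have [g' gg [c sg]] := up g; have [h' hh [c' sh]] := up h.
  have /card_gt0P[k kg] : 0 < #|supp (val g).1| by rewrite triangle_card.
  have [|g2 [gg2 c2 s2 k2]] := @triangle_peak g' k c; first by rewrite sg.
  have [|h2 [hh2 c3 s3 k3]] := @triangle_peak h' k c'; first by rewrite sh -gh.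
  have E : g2 = h2.
    by apply: (@triangle_peak_uniq _ _ k) => //; rewrite s2 s3 sg sh.
  apply: (connect_trans gg); apply: (connect_trans gg2).
  by rewrite cs E; apply: connect_trans hh hh2.
have /andP[_ FK] := valP f; have /andP[_ FK'] := valP f'.
pose C (G : {set 'I_N}) := forall h : triangle, supp (val h).1 = G -> connect flink f h.
suff: C (supp (val f').1) by apply.
apply: (connect_inv (C := C) _ _ (Kconnected FK FK')) =>
  [h hf|G G' IH /and3P[GK GK' /eqP GG] h hG].
  exact: same.
have /eqP/cards2P[i [j [ij GE]]] := GG.
(* An edge of the subdivision on the common side of [G] and [G']. *)
pose a : lattice N m := [ffun k => inord (if k == i then m else (k == j))].
have aE k : a k = (if k == i then m else (k == j)) :> nat.
  by rewrite ffunE inordK //; case: (k == i) => //; case: (k == j); lia.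
have sa : supp a = G :&: G'.
  by rewrite GE; apply/setP=> k; rewrite [LHS]inE aE !inE; case: (k == i);
    rewrite ?m_gt0 //; case: (k == j).
have ta : mass a = m.+1.
  rewrite /mass (bigD1 i) //= (bigD1 j) /=; last by rewrite eq_sym.
  rewrite !aE eqxx eq_sym (negbTE ij) eqxx big1 ?addn0 ?addn1 // => k /andP[ki kj].
  by rewrite aE (negbTE ki) (negbTE kj).
have pe : is_edge K (a, G :&: G').
  rewrite /is_edge /= ta eqxx GG sa subxx !andbT /=.
  by apply/exists_inP; exists G => //; apply: subsetIl.
have ext (H : {set 'I_N}) : H \in K -> G :&: G' \subset H ->
    exists f0 : triangle, supp (val f0).1 = H /\ side_of (a, G :&: G') (val f0).
  move=> HK sH; have [k kE] : exists k, H :\: (G :&: G') = [set k].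
    by apply/cards1P; rewrite cardsDS // K3 // GG.
  have /setDP[kH kG] : k \in H :\: (G :&: G') by rewrite kE inE.
  have sk : supp (incr a k) = H.
    by rewrite supp_incr ?ta // sa -kE setUC -{2}(setID H (G :&: G')) (setIidPr sH).
  have ut : is_triangle K (incr a k,
    true) by rewrite /is_triangle /= mass_incr ?ta ?addn1 ?eqxx ?sk.
  exists (Sub _ ut : triangle); rewrite SubK; split=> //.
  by rewrite /side_of /=; apply/existsP; exists k; rewrite kG /=.
have [g [gG gp]] := ext G GK (subsetIl _ _);
  have [g' [gG' gp']] := ext G' GK' (subsetIr _ _).
apply: (connect_trans (IH g gG)); apply: (@connect_trans _ _ g').
  exact/connect1/(flinkI pe).
by apply: same; rewrite gG' hG.
Qed.

End SubdivisionShape.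

(** * Counting paths in nearly degenerate graphs *)

Section Degeneracy.
Variables (T : finType) (e : rel T) (g : nat).
Hypothesis e_sym : symmetric e.
Hypothesis e_irr : irreflexive e.

Let edges_in (W : {set T}) : {set {set T}} :=
  [set E in [set [set p.1; p.2] | p : T * T & e p.1 p.2] | E \subset W].

Hypothesis sparse : forall W : {set T}, #|edges_in W| <= 3 * #|W| + 3 * g.

Lemma handshake (W : {set T}) : \sum_(x in W) #|[set y in W | e x y]| <= 2 * #|edges_in W|.
Proof.
have deg x : x \in W -> #|[set y in W | e x y]| <= #|[set E in edges_in W | x \in E]|.
  move=> xW; rewrite -(card_in_imset (f := fun y => [set x; y])); last first.
    move=> y z /setIdP[_ xy] /setIdP[_ xz] /setP/(_ y); rewrite !inE eqxx orbT.
    by case/esym/orP=> /eqP // yx; rewrite yx e_irr in xy.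
  apply/subset_leq_card/subsetP=> _ /imsetP[y /setIdP[yW xy] ->].
  rewrite !inE eqxx /= subUset !sub1set xW yW !andbT.
  by apply/imsetP; exists (x, y); rewrite ?inE.
apply: (@leq_trans (\sum_(x in W) #|[set E in edges_in W | x \in E]|)).
  exact: leq_sum.
under eq_bigr => x _ do rewrite -sum1dep_card.
rewrite (exchange_big_dep (mem (edges_in W))) /=; last by move=> x E _ /andP[].
rewrite mulnC -sum_nat_const; apply: leq_sum => E EW; rewrite sum1dep_card.
move: EW; rewrite inE => /andP[/imsetP[[x y] _ ->] _].
apply: (@leq_trans #|[set x; y]|); last by rewrite cards2; case: eqP.
by apply/subset_leq_card/subsetP=> z; rewrite inE => /andP[_ /andP[]].
Qed.

(** Remove vertices of degree at most 11 while there are any, [out x]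
    being the neighbours of [x] that remain when [x] is removed.  In what is
    left, the set [C], all degrees are at least 12; there are at least [6 |C|]
    edges then, and at most [3 |C| + 3 g], so [|C| <= g]. *)
Lemma peeling : exists (C : {set T}) (out : T -> {set T}), [/\ #|C| <= g,
  forall x, #|out x| <= 11 &
  forall x y, e x y -> [|| y \in out x, x \in out y | (x \in C) && (y \in C)]].
Proof.
suff: forall n (W : {set T}), #|W| <= n -> exists (C : {set T}) (out : T ->
  {set T}), [/\ #|C| <= g,
    forall x, #|out x| <= 11 & forall x y, x \in W -> y \in W -> e x y ->
      [|| y \in out x, x \in out y | (x \in C) && (y \in C)]].
  move=> /(_ #|T| setT (max_card _))[C [out [Cg out11 cov]]]; exists C, out; split=> // x y.
  exact: cov.
elim=> [|n IHn] W Wn.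
  exists set0, (fun=> set0); split=> [|x|x y xW]; rewrite ?cards0 //.
  by move: Wn; rewrite leqn0 cards_eq0 => /eqP W0; rewrite W0 inE in xW.
have [x /andP[xW x11]|big] := pickP (fun x => (x \in W) && (#|[set y in W | e x y]| <= 11)).
  have [|C [out [Cg out11 cov]]] := IHn (W :\ x).
    by rewrite (cardsD1 x) xW in Wn.
  exists C, (fun y => if y == x then [set z in W | e x z] else out y); split=> //.
    by move=> y; case: eqP.
  move=> y z yW zW yz; have [yx0|yx] := eqVneq y x; first by rewrite inE zW -yx0 yz.
  have [zx0|zx] := eqVneq z x; first by rewrite [y \in _]inE yW -zx0 e_sym yz orbT.
  by apply: cov; rewrite ?inE ?yx ?zx.
exists W, (fun=> set0); split=> [|x|x y -> ->]; rewrite ?cards0 ?orbT //.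
have := handshake W; have := sparse W.
suff : 12 * #|W| <= \sum_(x in W) #|[set y in W | e x y]| by lia.
rewrite mulnC -sum_nat_const; apply: leq_sum => x xW.
by have := big x; rewrite xW /= ltnNge => ->.
Qed.

End Degeneracy.

Section PathWeights.
Variables (R : rcfType) (T : finType).
Local Open Scope ring_scope.
Implicit Types (w : T -> T -> R) (x y : T) (p : seq T).

Fixpoint path_weight w x p : R :=
  if p is y :: p' then w x y * path_weight w y p' else 1.

Definition total_weight w L x : R := \sum_(p : L.-tuple T) path_weight w x p.

Lemma total_weight0 w x : total_weight w 0 x = 1.
Proof.
rewrite /total_weight (big_pred1 [tuple]) //= => p; apply/esym/eqP.
by rewrite (tuple0 p).
Qed.

Lemma total_weightS w L x :
  total_weight w L.+1 x = \sum_y w x y * total_weight w L y.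
Proof.
rewrite /total_weight; under [RHS]eq_bigr => y _ do rewrite mulr_sumr.
rewrite pair_bigA /= (reindex (fun q : T * L.-tuple T => [tuple of q.1 :: q.2])) //=.
exists (fun p : L.+1.-tuple T => (thead p, [tuple of behead p])) => [[y p] _|p _] /=.
  by congr pair; apply: val_inj.
by rewrite [RHS]tuple_eta.
Qed.

Variable w : T -> T -> R.
Hypothesis w_ge0 : forall x y, 0 <= w x y.

Lemma path_weight_ge0 x p : 0 <= path_weight w x p.
Proof. by elim: p x => [|y p IHp] x //=; rewrite mulr_ge0. Qed.

Variable a : R.
Hypothesis row_sum : forall x, \sum_y w x y <= a.

Lemma bound_ge0 (x : T) : 0 <= a.
Proof. by apply: le_trans (row_sum x); apply: sumr_ge0. Qed.

Lemma total_weight_le L x : total_weight w L x <= a ^+ L.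
Proof.
elim: L x => [|L IHL] x; first by rewrite total_weight0.
rewrite total_weightS exprS.
apply: (@le_trans _ _ (\sum_y w x y * a ^+ L)).
  by apply: ler_sum => y _; rewrite ler_wpM2l.
by rewrite -mulr_suml ler_wpM2r // exprn_ge0 // (bound_ge0 x).
Qed.

(** Reversed weights have bounded column sums only, so the bound holds after
    summation over all starting points. *)
Lemma total_weight_rev_le L x : total_weight (fun y z => w z y) L x <= #|T|%:R * a ^+ L.
Proof.
have ge0 M y : 0 <= total_weight (fun y z => w z y) M y.
  apply: sumr_ge0 => p _; elim: (tval p) y => [|z q IHq] y //=.
  by rewrite mulr_ge0.
apply: (@le_trans _ _ (\sum_y total_weight (fun y z => w z y) L y)).
  by rewrite (bigD1 x) //= lerDl sumr_ge0.
elim: L => [|L IHL].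
  under eq_bigr => y _ do rewrite total_weight0.
  by rewrite sumr_const mulr1.
under eq_bigr => y _ do rewrite total_weightS.
rewrite exchange_big /=; under eq_bigr => y _ do rewrite -mulr_suml.
apply: (@le_trans _ _ (\sum_y a * total_weight (fun y z => w z y) L y)).
  by apply: ler_sum => y _; rewrite ler_wpM2r.
by rewrite -mulr_sumr exprS mulrCA ler_wpM2l // (bound_ge0 x).
Qed.

End PathWeights.

Section PathCount.
Variables (R : rcfType) (T : finType) (e : rel T) (C : {set T}) (out : T -> {set T}).
Local Open Scope ring_scope.
Variable r : R.
Hypothesis r_ge1 : 1 <= r.
Hypothesis degree_le : forall x, #|[set y | e x y]|%:R <= r ^+ 2.
Hypothesis out11 : forall x, (#|out x| <= 11)%N.
Hypothesis e_sym : symmetric e.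
Hypothesis covered : forall x y, e x y ->
  [|| y \in out x, x \in out y | (x \in C) && (y \in C)].

Let w x y : R := (e x y)%:R * (if y \in out x then r else r^-1).

Let r_gt0 : 0 < r.
Proof. by apply: lt_le_trans r_ge1. Qed.

Let w_ge0 x y : 0 <= w x y.
Proof. by rewrite mulr_ge0 //; case: ifP => _; rewrite ?invr_ge0 ltW. Qed.

Let row_sum x : \sum_y w x y <= 12 * r.
Proof.
apply: (@le_trans _ _ (\sum_(y in out x) r + \sum_(y | e x y) r^-1)).
  rewrite [X in _ <= X + _]big_mkcond [X in _ <= _ + X]big_mkcond /= -big_split /=.
  apply: ler_sum => y _; rewrite /w; have rV : 0 <= r^-1 by rewrite invr_ge0 ltW.
  by case: ifP => _; case: (e x y); rewrite ?mul1r ?mul0r ?addr0 ?add0r ?lerDl ?(ltW r_gt0).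
rewrite !sumr_const -[r *+ _]mulr_natr -[r^-1 *+ _]mulr_natr.
rewrite (_ : 12 * r = r * 11%:R + r^-1 * r ^+ 2); last first.
  by rewrite expr2 mulrA mulVf ?gt_eqF // mul1r; ring.
apply: lerD; apply: ler_wpM2l; rewrite ?invr_ge0 ?(ltW r_gt0) ?ler_nat //.
by apply: le_trans (degree_le x); rewrite ler_nat cardsE.
Qed.

(** Outside [C] one of the two directions of an edge has weight [r], and the
    other at least [r^-1].  An edge inside [C] costs a factor [r ^- 2] and is
    charged to its second end. *)
Lemma two_way_weight x p : path e x p ->
  (r ^- 2) ^+ (count (mem C) p) <= path_weight w x p * path_weight (fun y z => w z y) x p.
Proof.
elim: p x => [|y p IHp] x /=; first by rewrite mulr1.
case/andP=> xy /IHp IH;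
  rewrite exprD mulrACA ler_pM // ?exprn_ge0 ?invr_ge0 ?exprn_ge0 ?(ltW r_gt0) //.
have rV1 : r^-1 <= 1 by rewrite invf_le1.
have r2 : r ^- 2 <= 1 by rewrite invf_le1 ?exprn_gt0 // exprn_ege1.
have pow (b : bool) : (r ^- 2) ^+ b <= 1 by case: b.
have ge1 z z' : z' \in out z -> e z z' -> 1 <= w z z' * w z' z.
  rewrite /w (e_sym z' z) => -> ->; rewrite !mul1r; case: ifP => _.
    by rewrite -expr2 exprn_ege1.
  by rewrite mulfV ?gt_eqF.
case/or3P: (covered xy) => [yx|xy'|/andP[xC yC]].
- exact: le_trans (pow _) (ge1 _ _ yx xy).
- by apply: le_trans (pow _) _; rewrite mulrC ge1 // e_sym.
rewrite yC expr1 /w (e_sym y x) xy !mul1r -exprVn expr2.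
have rVr : r^-1 <= r by apply: le_trans rV1 r_ge1.
by rewrite ler_pM ?invr_ge0 ?(ltW r_gt0) //; case: ifP.
Qed.

(** By [two_way_weight] and the inequality between means, a simple path or its
    reversal has weight at least of order [r ^- k], as it visits each vertex of
    [C] at most once. *)
Lemma path_count (s : T) (L k : nat) : (#|C| <= k)%N ->
  #|[set p : L.-tuple T | path e s p && uniq (s :: p)]|%:R
    <= r ^+ k * ((#|T|.+1)%:R * (12 * r) ^+ L).
Proof.
move=> Ck; have rk : 0 <= r ^+ k by rewrite exprn_ge0 // ltW.
apply: (@le_trans _ _ (\sum_(p : L.-tuple T)
    r ^+ k * (path_weight w s p + path_weight (fun y z => w z y) s p))).
  rewrite -sum1_card natr_sum [X in X <= _]big_mkcond /=.
  have ge0 (p : seq T) : 0 <= path_weight w s p + path_weight (fun y z => w z y) s p.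
    by rewrite addr_ge0 //; apply: path_weight_ge0.
  apply: ler_sum => p _; rewrite inE; case: ifP => [/andP[pP /andP[_ pu]]|_];
    last by rewrite mulr_ge0.
  set b := path_weight w s p; set c := path_weight _ s p.
  have b0 : 0 <= b by apply: path_weight_ge0.
  have c0 : 0 <= c by apply: path_weight_ge0.
  (* [b + c] is at least twice the geometric mean of [b] and [c]. *)
  have bc : (r ^- k) ^+ 2 <= (b + c) ^+ 2.
    apply: (@le_trans _ _ (b * c)); last by rewrite -subr_ge0; nra.
    apply: le_trans (two_way_weight pP).
    rewrite -exprVn -!exprM mulnC exprM exprVn; apply: ler_wiXn2l.
      by rewrite invr_ge0 exprn_ge0 // ltW.
      by rewrite invf_le1 ?exprn_gt0 // exprn_ege1.
    apply: leq_trans Ck; rewrite -size_filter -(card_uniqP (filter_uniq _ pu)).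
    by apply/subset_leq_card/subsetP=> x; rewrite mem_filter => /andP[].
  rewrite -ler_pdivrMl ?exprn_gt0 // mulr1.
  by move: bc; rewrite ler_sqr // nnegrE ?addr_ge0 ?invr_ge0.
rewrite -mulr_sumr ler_wpM2l // big_split /= -[#|T|.+1]add1n natrD mulrDl mul1r.
by rewrite lerD ?total_weight_le ?total_weight_rev_le.
Qed.

End PathCount.

(** * Growth of the tree *)

Local Open Scope ring_scope.

Section Growth.
Variables (R : realType) (T : finType) (e : rel T) (s : T).
Hypothesis e_sym : symmetric e.
Hypothesis e_irr : irreflexive e.
Hypothesis e_connected : forall x y, connect e x y.
Implicit Types (t u : subtree T) (E : {set T}) (P : pred (subtree T)) (k : nat).
Local Notation bd := (boundary e).

Definition seed : subtree T := ([set s], set0).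

(** The probability of [P] after [k] further steps from [u].  The law of the
    trees is defined by recursion on the last step; potentials need recursion
    on the first. *)
Fixpoint final_prob k P u : R :=
  if k is j.+1 then
    (\sum_(E in bd u) final_prob j P (add_edge u E)) / #|bd u|%:R
  else (P u)%:R.

Lemma tree_law_shift k i P :
  \sum_t tree_law R e s (i + k) t * (P t)%:R = \sum_u tree_law R e s i u * final_prob k P u.
Proof.
elim: k i => [|k IHk] i; first by rewrite addn0.
rewrite -addSnnS IHk /=.
under eq_bigr => t _ do rewrite mulr_suml.
rewrite exchange_big /=; apply: eq_bigr => u _.
under eq_bigr => t _ do rewrite -mulrA.
rewrite -mulr_sumr; congr (_ * _).
rewrite mulr_suml (eq_bigr (fun t => \sum_(E in bd u)
  (add_edge u E == t)%:R / #|bd u|%:R * final_prob k P t)); last by move=> t _;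
    rewrite mulr_suml.
rewrite exchange_big /=; apply: eq_bigr => E _.
rewrite (bigD1 (add_edge u E)) //= eqxx mul1r mulrC big1 ?addr0 // => t.
by rewrite eq_sym => /negbTE->; rewrite !mul0r.
Qed.

Lemma spanning_tree_probE P : spanning_tree_prob R e s P = final_prob #|T|.-1 P seed.
Proof.
rewrite /spanning_tree_prob big_mkcond /= (eq_bigr (fun t =>
  tree_law R e s #|T|.-1 t * (P t)%:R)).
  rewrite -[#|T|.-1]add0n tree_law_shift (bigD1 seed) //= eqxx mul1r big1 ?addr0 // => u.
  by move=> /negbTE uroot; rewrite -/seed uroot mul0r.
by move=> t _; case: (P t); rewrite ?mulr1 ?mulr0.
Qed.

(** What holds of every tree that occurs in the process. *)
Definition grown u := [/\ s \in u.1, u.2 \subset edges e & forall E, E \in u.2 ->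
  E \subset u.1].

Lemma edgesE E : reflect (exists x y, e x y /\ E = [set x; y]) (E \in edges e).
Proof.
apply: (iffP imsetP) => [[[x y]]|[x [y [xy ->]]]].
  by rewrite inE /= => xy ->; exists x, y.
by exists (x, y); rewrite ?inE.
Qed.

Lemma edges2 x y : ([set x; y] \in edges e) = e x y.
Proof.
apply/edgesE/idP => [[a [b [ab /setP xyE]]]|xy]; last by exists x, y.
have xa := xyE x; have ya := xyE y; have ax := xyE a; have bx := xyE b.
move: xa ya ax bx; rewrite !inE !eqxx ?orbT /=.
case/esym/orP=> /eqP->; case/esym/orP=> /eqP->; rewrite ?orbb //.
- by move=> _ /eqP ba; rewrite ba e_irr in ab.
- by rewrite e_sym.
- by move=> /eqP ba; rewrite ba e_irr in ab.
Qed.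

Lemma boundaryP u E : reflect (exists x y, [/\ e x y, E = [set x;
  y], x \in u.1 & y \notin u.1])
  (E \in bd u).
Proof.
apply: (iffP setIdP) => [[/edgesE[x [y [xy ->]]]]|[x [y [xy -> xu yu]]]]; last first.
  split; first by rewrite edges2.
  suff -> : [set x; y] :&: u.1 = [set x] by rewrite cards1.
  apply/setP=> z; rewrite !inE andb_orl; have [->|_] := eqVneq z x; first by rewrite xu.
  by have [->|//] := eqVneq z y; rewrite (negbTE yu).
have [xu|xu] := boolP (x \in u.1); have [yu|yu] := boolP (y \in u.1).
- rewrite (setIidPl _) ?subUset ?sub1set ?xu // cards2 => /eqP[/eqP].
  by rewrite eqb0 negbK => /eqP xyE; rewrite xyE e_irr in xy.
- by exists x, y.
- by exists y, x; rewrite e_sym setUC.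
suff -> : [set x; y] :&: u.1 = set0 by rewrite cards0.
apply/setP=> z; rewrite !inE andb_orl; have [->|_] := eqVneq z x;
  first by rewrite (negbTE xu) !andbF.
by have [->|//] := eqVneq z y; rewrite (negbTE yu).
Qed.

Lemma grown_seed : grown seed.
Proof. by split=> [||E]; rewrite ?inE ?sub0set. Qed.

Lemma grown_add u E : grown u -> E \in bd u -> grown (add_edge u E).
Proof.
case=> su ue uS /setIdP[Ee _]; split=> /= [||F].
- by rewrite inE su.
- by rewrite subUset sub1set Ee.
rewrite !inE => /predU1P[->|/uS]; first exact: subsetUr.
by move=> Fu; apply: subset_trans Fu (subsetUl _ _).
Qed.

Lemma card_add u E : E \in bd u -> #|(add_edge u E).1| = #|u.1|.+1.
Proof.
case/boundaryP=> x [y [_ -> xu yu]]; rewrite /= (_ : u.1 :|: _ = y |: u.1) ?cardsU1 ?yu //.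
by apply/setP=> z; rewrite !inE; have [->|_] := eqVneq z x; rewrite ?xu ?orbT //= orbC.
Qed.

Lemma boundary_gt0 u : grown u -> u.1 != setT -> (0 < #|bd u|)%N.
Proof.
case=> su _ _ uT; have /subsetPn[y _ yu] : ~~ (setT \subset u.1) by rewrite subTset.
have [x [z [xu zu xz]]] := connect_exit su yu (e_connected s y).
by apply/card_gt0P; exists [set x; z]; apply/boundaryP; exists x, z.
Qed.

(** Backward induction over the process: a grown tree has a boundary edge
    until it spans the graph, and [k] counts the missing vertices. *)
Lemma growth_ind (Q : nat -> subtree T -> Prop) :
  (forall u, grown u -> u.1 = setT -> Q 0%N u) ->
  (forall k u, grown u -> (0 < #|bd u|)%N -> (forall E, E \in bd u ->
    Q k (add_edge u E)) -> Q k.+1 u) ->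
  Q #|T|.-1 seed.
Proof.
move=> Q0 QS; suff all_k k u : grown u -> (#|u.1| + k = #|T|)%N -> Q k u.
  apply: all_k; first exact: grown_seed.
  by rewrite cards1 add1n prednK //; apply/card_gt0P; exists s.
elim: k u => [|k IHk] u gu uk.
  by apply: Q0 => //; apply/eqP; rewrite eqEcard subsetT cardsT -uk addn0 leqnn.
have uT : u.1 != setT.
  by apply: contra_eq_neq uk => ->; rewrite cardsT -[X in _ != X]addn0 eqn_add2l.
apply: QS => //; first exact: boundary_gt0.
move=> E Eb; apply: IHk; first exact: grown_add.
by rewrite card_add // addSnnS.
Qed.

Lemma final_prob_compl P : final_prob #|T|.-1 P seed + final_prob #|T|.-1 (predC P) seed
  = 1.
Proof.
apply: (growth_ind (Q := fun k u =>
  final_prob k P u + final_prob k (predC P) u = 1)) => [u _ _|k u _ b0 IH] /=.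
  by case: (P u); rewrite ?addr0 ?add0r.
rewrite -mulrDl -big_split /= (eq_bigr (fun=> 1)); last by move=> E /IH.
by rewrite sumr_const divff // pnatr_eq0 -lt0n.
Qed.

Lemma final_prob_ge0 k P u : 0 <= final_prob k P u.
Proof.
by elim: k u => [|k IHk] u //=; rewrite divr_ge0 ?sumr_ge0.
Qed.

(** The optional stopping argument: [Phi] dominates the indicator of [P] when
    the tree spans the graph, and along the process, with the clock [th]
    advanced by the inverse of the boundary size, it is a supermartingale. *)
Lemma final_prob_le P (Phi : R -> subtree T -> R) :
  (forall u th, grown u -> u.1 = setT -> (P u)%:R <= Phi th u) ->
  (forall u th, grown u -> u.1 != setT -> (0 < #|bd u|)%N ->
     \sum_(E in bd u) Phi (th + #|bd u|%:R^-1) (add_edge u E) <= #|bd u|%:R * Phi th u) ->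
  forall th, final_prob #|T|.-1 P seed <= Phi th seed.
Proof.
move=> Phi0 PhiS.
apply: (growth_ind (Q := fun k u => forall th, final_prob k P u <= Phi th u)) =>
  [u gu uT th|k u gu b0 IH th] /=.
  exact: Phi0.
rewrite ler_pdivrMr ?ltr0n // mulrC; apply: le_trans (PhiS u th gu _ b0).
  by apply: ler_sum => E /IH.
apply: contraTneq b0 => uT; rewrite -leqNgt leqn0 cards_eq0; apply/eqP/setP=> E;
  rewrite in_set0.
by apply/negP=> /boundaryP[x [y [_ _ _]]]; rewrite uT inE.
Qed.

End Growth.

(** * A fixed path appears early *)

Section PathPotential.
Variables (R : realType) (T : finType) (e : rel T) (s : T).
Hypothesis e_sym : symmetric e.
Hypothesis e_irr : irreflexive e.
Variables (L : nat) (p : L.-tuple T).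
Hypothesis p_uniq : uniq (s :: p).
Variables (lam t : R).
Hypothesis lam_ge0 : 0 <= lam.
Implicit Types (u : subtree T) (E : {set T}) (i j : 'I_L).
Local Notation bd := (boundary e).

Definition stop k : T := nth s (s :: p) k.
Definition step k : {set T} := [set stop k; stop k.+1].

(** In a tree rooted at [s] that contains the path [p], each vertex of the path
    is the parent of the next one.  Hence [p] can only appear if no vertex of
    the path has been reached by an edge other than the preceding one of [p]. *)
Definition alive u := [forall i : 'I_L, (stop i.+1 \in u.1) ==> (step i \in u.2)].

Definition missing u := #|[set i : 'I_L | step i \notin u.2]|.

(** The Laplace transform at [lam] of the sum of [missing u] exponential
    waiting times of rate 1, as a bound for the remaining time. *)
Definition path_potential th u : R :=
  if alive u then expR (lam * (t - th)) * (1 + lam) ^- missing u else 0.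

Lemma stop_inj k l : (k <= L)%N -> (l <= L)%N -> stop k = stop l -> k = l.
Proof.
move=> kL lL kl; apply/eqP; rewrite -(nth_uniq s _ _ p_uniq) /= ?size_tuple ?ltnS //.
exact/eqP.
Qed.

Lemma aliveP u i : alive u -> stop i.+1 \in u.1 -> step i \in u.2.
Proof. by move/forallP/(_ i)/implyP. Qed.

Lemma alive_prefix u k l : grown e s u -> alive u -> (k <= l <= L)%N ->
  stop l \in u.1 -> stop k \in u.1.
Proof.
case=> _ _ uS al /andP[kl lL] lu; rewrite -(subKn kl); move: (l - k)%N => n.
elim: n => [|n IHn]; first by rewrite subn0.
have [le|lt] := leqP l n.
  by have -> : (l - n.+1 = l - n)%N by lia.
have nL : (l - n.+1 < L)%N by lia.
have Sn : (l - n)%N = (l - n.+1).+1 by lia.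
rewrite Sn in IHn; have /uS := aliveP (i := Ordinal nL) al IHn.
by rewrite subUset !sub1set => /andP[].
Qed.

Lemma alive_boundary u i : grown e s u -> alive u -> step i \in bd u ->
  stop i \in u.1 /\ stop i.+1 \notin u.1.
Proof.
move=> gu al /(boundaryP e_sym e_irr)[x [y [xy /setP sE xu yu]]].
have [iu|iu] := boolP (stop i.+1 \in u.1).
  have : y \in step i by rewrite sE !inE eqxx orbT.
  have := alive_prefix (k := i) gu al _ iu; rewrite leqnSn ltn_ord => /(_ isT) iu'.
  by rewrite !inE => /orP[]/eqP yE; rewrite yE ?iu ?iu' in yu.
split=> //; have : x \in step i by rewrite sE !inE eqxx.
by rewrite !inE => /orP[]/eqP xE; rewrite xE ?(negbTE iu) in xu.
Qed.

(** The visited part of the path is an initial segment, so only the edge that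
    leaves this segment can be added. *)
Lemma alive_boundary_uniq u i j : grown e s u -> alive u ->
  step i \in bd u -> step j \in bd u -> i = j.
Proof.
move=> gu al ib jb; have [iu iu'] := alive_boundary gu al ib.
have [ju ju'] := alive_boundary gu al jb; apply: val_inj => /=.
have lt k l : stop k \in u.1 -> stop l.+1 \notin u.1 -> (k <= L)%N -> (k <= l)%N.
  move=> ku lu kL; rewrite leqNgt; apply: contra lu => lk.
  by apply: (alive_prefix gu al _ ku); rewrite lk.
by apply/eqP; rewrite eqn_leq (lt _ _ iu ju') ?(lt _ _ ju iu') ?(ltnW (ltn_ord _)).
Qed.

(** Let [stop i.+1] have been reached by a foreign edge.  The missing edge
    [step i] can still be added if [stop i] is not in the tree; but then
    [step i] reaches [stop i], in place of the edge [step i.-1]. *)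
Lemma dead_add u E : grown e s u -> E \in bd u -> ~~ alive u -> ~~ alive (add_edge u E).
Proof.
move=> gu Eb; have [su ue uS] := gu; rewrite negb_forall => /existsP[i].
rewrite negb_imply => /andP[iu iE]; rewrite negb_forall.
have [EE|EE] := eqVneq (step i) E; last first.
  by apply/existsP; exists i; rewrite negb_imply /= !inE iu (negbTE EE).
have iu' : stop i \notin u.1.
  apply/negP=> iu'; move: Eb;
    rewrite -EE => /(boundaryP e_sym e_irr)[x [y [_ /setP sE _ yu]]].
  have : y \in step i by rewrite sE !inE eqxx orbT.
  by rewrite !inE => /orP[]/eqP yE; rewrite yE ?iu ?iu' in yu.
case: i => [[|k] kL] /= in iu iE EE iu' *; first by rewrite su in iu'.
apply/existsP; exists (Ordinal (ltnW kL)); rewrite negb_imply /= !inE -EE !inE eqxx orbT /=.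
rewrite negb_or; apply/andP; split.
  apply/negP=> /eqP/setP/(_ (stop k));
    rewrite !inE eqxx /= => /esym/orP[]/eqP/stop_inj; lia.
by apply: contra iu' => /uS; rewrite subUset !sub1set => /andP[].
Qed.

Lemma missing_add u E : grown e s u -> alive u -> E \in bd u ->
  (missing u <= missing (add_edge u E) + [exists i : 'I_L, step i == E])%N.
Proof.
move=> gu al Eb; have sub : [set i : 'I_L | step i \notin u.2] \subset
    [set i : 'I_L | step i \notin (add_edge u E).2] :|: [set i : 'I_L | step i == E].
  by apply/subsetP=> i; rewrite !inE negb_or => ->; case: (_ == E).
apply: leq_trans (subset_leq_card sub) _;
  rewrite (leq_trans (leq_card_setU _ _)) // leq_add2l.
have [/existsP[i iE]|no] := boolP [exists i : 'I_L, step i == E].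
  apply: (@leq_trans #|[set i]|); last by rewrite cards1.
  apply/subset_leq_card/subsetP=> j; rewrite !inE => /eqP jE.
  by apply/eqP/(alive_boundary_uniq gu al); rewrite ?jE ?(eqP iE).
rewrite leqn0 cards_eq0; apply/eqP/setP=> j; rewrite !inE.
by apply: contraNF no => jE; apply/existsP; exists j.
Qed.

Let M_gt0 : 0 < 1 + lam. Proof. by rewrite ltr_pwDl. Qed.

(** At most one of the [b] boundary edges extends the path, and it gains the
    factor [1 + lam]; the average factor [1 + lam / b] is compensated by the
    factor [exp (- lam / b)] from the clock. *)
Lemma path_potential_step u th : grown e s u -> (0 < #|bd u|)%N ->
  \sum_(E in bd u) path_potential (th + #|bd u|%:R^-1) (add_edge u E)
    <= #|bd u|%:R * path_potential th u.
Proof.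
move=> gu b0; rewrite /path_potential; have [al|dead] := boolP (alive u); last first.
  by rewrite mulr0 big1 // => E Eb; rewrite (negbTE (dead_add gu Eb dead)).
set b : R := #|bd u|%:R; have bp : 0 < b by rewrite ltr0n.
set c := expR (lam * (t - (th + b^-1))); have c0 : 0 <= c := expR_ge0 _.
set q := missing u; have q0 : 0 <= (1 + lam) ^- q by rewrite invr_ge0 exprn_ge0 // ltW.
have cE : expR (lam * (t - th)) = c * expR (lam / b).
  by rewrite /c -expRD; congr expR; field; rewrite gt_eqF.
pose hit (E : {set T}) := [exists i : 'I_L, step i == E].
apply: (@le_trans _ _ (\sum_(E in bd u) c * (1 + lam) ^- q * (1 + lam * (hit E)%:R))).
  apply: ler_sum => E Eb; case: ifP => _; last first.
    by rewrite !mulr_ge0 // addr_ge0 // mulr_ge0.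
  rewrite -mulrA ler_wpM2l // mulrC ler_pdivlMr ?exprn_gt0 // mulrC.
  rewrite ler_pdivrMr ?exprn_gt0 //.
  have := missing_add gu al Eb; rewrite -/q -/(hit E); case: (hit E) => /= le.
    by rewrite mulr1 -exprS ler_weXn2l ?lerDl // -addn1.
  by rewrite mulr0 addr0 mul1r ler_weXn2l ?lerDl // -[leqRHS]addn0.
rewrite -mulr_sumr big_split /= -mulr_sumr sumr_const -natr_sum.
have hit1 : (\sum_(E in bd u) hit E <= 1)%N.
  rewrite -big_mkcondr /= sum1dep_card /hit;
    apply/card_le1P => E /setIdP[Eb /existsP[i /eqP iE]] F.
  rewrite [RHS]inE; apply/setIdP/eqP => [[Fb /existsP[j /eqP jE]]|->]; last first.
    by split=> //; apply/existsP; exists i; apply/eqP.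
  by rewrite -iE -jE (alive_boundary_uniq (i := i) (j := j) gu al) ?iE ?jE.
rewrite cE -mulrA [b * _]mulrC -!mulrA ler_wpM2l //.
rewrite [X in _ <= X]mulrC -mulrA ler_wpM2l // -/b.
apply: (@le_trans _ _ (b + lam)).
  by rewrite lerD2l ler_piMr // lern1.
have := expR_ge1Dx (lam / b);
  rewrite -(ler_pM2l bp) mulrDr mulr1 mulrCA mulfV ?gt_eqF // mulr1.
by [].
Qed.

Lemma path_potential_seed : path_potential 0 (seed s) = expR (lam * t) * (1 + lam) ^- L.
Proof.
rewrite /path_potential subr0 (_ : alive _).
  congr (_ * _ ^- _); rewrite /missing -[RHS]card_ord -cardsT; apply: eq_card => i.
  by rewrite !inE.
apply/forallP=> i; apply/implyP; rewrite inE => /eqP si.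
by have := @stop_inj i.+1 0 (ltn_ord i) isT si.
Qed.

Lemma path_potential_final th u : (forall i, step i \in u.2) -> th <= t ->
  1 <= path_potential th u.
Proof.
move=> pu tht; rewrite /path_potential (_ : alive u); last first.
  by apply/forallP=> i; rewrite pu implybT.
rewrite (_ : missing u = 0%N); last first.
  by apply/eqP; rewrite cards_eq0; apply/eqP/setP=> i; rewrite !inE pu.
rewrite expr0 invr1 mulr1 (le_trans _ (expR_ge1Dx _)) // lerDl mulr_ge0 // subr_ge0 //.
Qed.

Lemma path_potential_ge0 th u : 0 <= path_potential th u.
Proof.
rewrite /path_potential; case: ifP => // _.
by rewrite mulr_ge0 ?expR_ge0 // invr_ge0 exprn_ge0 // ltW.
Qed.

End PathPotential.

(** * The tree spans late *)

Section TimePotential.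
Variables (R : realType) (T : finType) (e : rel T) (s : T).
Hypothesis e_sym : symmetric e.
Hypothesis e_irr : irreflexive e.
Variables (route : T -> seq T) (D : nat).
Hypothesis route_path : forall v, path e v (route v).
Hypothesis route_last : forall v, last v (route v) = s.
Hypothesis route_size : forall v, (size (route v) <= D)%N.
Variable t : R.
Implicit Types (u : subtree T) (E : {set T}) (v : T).
Local Notation bd := (boundary e).

(** The number of edges of the route from [v] to [s] that precede its first
    vertex in the tree. *)
Definition gap u v : nat := find [in u.1] (v :: route v).

Definition cover_mass u : R := \sum_(v | v \notin u.1) 2 ^+ gap u v.

Definition time_potential th u : R :=
  if t < th then 1 else expR ((th - t) / 2) * cover_mass u.

Lemma gap_le u v : s \in u.1 -> (gap u v <= size (route v))%N.
Proof.
move=> su; rewrite -ltnS -[(size _).+1]/(size (v :: route v)) -has_find.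
by apply/hasP; exists s => //; rewrite -(route_last v) mem_last.
Qed.

Lemma gap_gt0 u v : v \notin u.1 -> (0 < gap u v)%N.
Proof. by rewrite /gap /= => /negbTE->. Qed.

Lemma gap_add u v E : (gap (add_edge u E) v <= gap u v)%N.
Proof. by apply: sub_find => x; rewrite !inE => ->. Qed.

Lemma gap_edge u v : s \in u.1 -> v \notin u.1 ->
  exists2 E, E \in bd u & (gap (add_edge u E) v < gap u v)%N.
Proof.
move=> su vu; have g0 := gap_gt0 vu; have gs := gap_le v su.
pose x := nth s (v :: route v) (gap u v).
pose y := nth s (v :: route v) (gap u v).-1.
have xu : x \in u.1.
  by apply: (@nth_find _ s [in u.1]); rewrite has_find.
have yu : y \notin u.1 by apply/negbT/(before_find s); rewrite prednK.
have yx : e y x.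
  have /(pathP s)/(_ (gap u v).-1) := route_path v; rewrite prednK // => /(_ gs).
  by rewrite /x /y -{4}(prednK g0).
exists [set x; y]; first by apply/(boundaryP e_sym e_irr); exists x, y; rewrite e_sym.
rewrite -(ltn_predK g0) ltnS leqNgt; apply/negP => /(before_find s).
by rewrite -/y /= !inE eqxx !orbT.
Qed.

(** Adding the edge where the route of [v] enters the tree halves the term of
    [v], and no other edge increases it. *)
Lemma gap_sum u v : grown e s u -> v \notin u.1 ->
  \sum_(E in bd u) (v \notin (add_edge u E).1)%:R * 2 ^+ gap (add_edge u E) v
    <= 2 ^+ gap u v * (#|bd u|%:R - 1 / 2) :> R.
Proof.
case=> su _ _ vu; have [E0 E0b E0g] := gap_edge su vu.
have le (E : {set T}) k : (gap (add_edge u E) v <= k)%N ->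
    (v \notin (add_edge u E).1)%:R * 2 ^+ gap (add_edge u E) v <= 2 ^+ k :> R.
  move=> gk; case: (_ \notin _); rewrite ?mul0r ?exprn_ge0 // mul1r.
  by rewrite ler_weXn2l // ler1n.
rewrite (bigD1 E0) //= (cardsD1 E0) E0b natrD.
have -> : 2 ^+ gap u v * (1%:R + #|bd u :\ E0|%:R - 1 / 2) =
    2 ^+ (gap u v).-1 + 2 ^+ gap u v * #|bd u :\ E0|%:R :> R.
  by rewrite -{1 3}(prednK (gap_gt0 vu)) exprS; field.
apply: lerD; first by apply: le; rewrite -ltnS prednK ?gap_gt0.
rewrite mulr_natr -sumr_const (eq_bigl [in bd u :\ E0]); last first.
  by move=> E; rewrite !inE andbC.
by apply: ler_sum => E _; apply/le/gap_add.
Qed.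

Lemma cover_mass_ge0 u : 0 <= cover_mass u.
Proof. by apply: sumr_ge0 => v _; rewrite exprn_ge0. Qed.

Lemma cover_mass_step u : grown e s u ->
  \sum_(E in bd u) cover_mass (add_edge u E) <= (#|bd u|%:R - 1 / 2) * cover_mass u.
Proof.
move=> gu; rewrite /cover_mass.
under eq_bigr => E _ do rewrite big_mkcond /=.
rewrite exchange_big /= mulr_sumr [X in _ <= X]big_mkcond /=.
apply: ler_sum => v _; case: ifP => vu.
  rewrite mulrC; apply: le_trans (gap_sum gu vu); apply: ler_sum => E _.
  by case: (v \in _); rewrite ?mul0r ?mul1r.
rewrite big1 // => E _; case: ifP => //; rewrite inE.
by move/negbT: vu; rewrite negbK => ->.
Qed.

Lemma cover_mass_ge2 u : u.1 != setT -> 2 <= cover_mass u.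
Proof.
rewrite -subTset => /subsetPn[v _ vu]; rewrite /cover_mass (bigD1 v) //=.
rewrite -[2]expr1 -[X in X <= _]addr0 lerD //; last by apply: sumr_ge0 => w _;
  rewrite exprn_ge0.
by rewrite ler_weXn2l ?ler1n ?gap_gt0.
Qed.

(** On average the mass is multiplied by at most [1 - 1 / (2 b)], and the clock
    contributes [exp (1 / (2 b))].  When the clock passes [t], the potential
    drops to 1: before that step it is at least [2 exp (- 1 / 2) >= 1], as some
    vertex is still missing. *)
Lemma time_potential_step u th : grown e s u -> u.1 != setT -> (0 < #|bd u|)%N ->
  \sum_(E in bd u) time_potential (th + #|bd u|%:R^-1) (add_edge u E)
    <= #|bd u|%:R * time_potential th u.
Proof.
move=> gu uT b0; rewrite /time_potential; set b : R := #|bd u|%:R.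
have b1 : 1 <= b by rewrite ler1n.
have bp : 0 < b by rewrite ltr0n.
have bV : b^-1 <= 1 by rewrite invf_le1.
have bV0 : 0 < b^-1 by rewrite invr_gt0.
case: (ltP t th) => tth.
  have -> : t < th + b^-1 by lra.
  by rewrite sumr_const mulr1.
case: (ltP t (th + b^-1)) => tth'.
  rewrite sumr_const -/b -[leLHS]mulr1 ler_pM2l //.
  have c2 := cover_mass_ge2 uT.
  have ex : 1 / 2 <= expR ((th - t) / 2) by have := expR_ge1Dx ((th - t) / 2); lra.
  by apply: (@le_trans _ _ (1 / 2 * 2)); [lra|apply: ler_pM => //; lra].
rewrite -mulr_sumr (_ : (th + b^-1 - t) / 2 = (th - t) / 2 + b^-1 / 2); last by field;
  rewrite gt_eqF.
rewrite expRD -mulrA mulrCA [b * _]mulrCA -[leLHS]mulrCA ler_wpM2l ?expR_ge0 //.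
apply: (@le_trans _ _ (expR (b^-1 / 2) * ((b - 1 / 2) * cover_mass u))).
  by rewrite ler_wpM2l ?expR_ge0 // cover_mass_step.
rewrite mulrA ler_wpM2r ?cover_mass_ge0 //.
rewrite -ler_pdivlMl ?expR_gt0 // -expRN mulrC.
have := expR_ge1Dx (- (b^-1 / 2));
  rewrite -(ler_pM2l bp) mulrDr mulr1 mulrN mulrA mulfV ?gt_eqF //.
lra.
Qed.

Lemma time_potential_seed : 0 <= t ->
  time_potential 0 (seed s) <= expR (- (t / 2)) * (#|T|%:R * 2 ^+ D).
Proof.
move=> t0; rewrite /time_potential ltNge t0 /= sub0r mulNr ler_wpM2l ?expR_ge0 //.
rewrite mulr_natl -sumr_const /cover_mass big_mkcond /=; apply: ler_sum => v _.
case: ifP => _; last exact: exprn_ge0.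
rewrite ler_weXn2l ?ler1n // (leq_trans _ (route_size v)) // gap_le //.
by rewrite inE.
Qed.

Lemma time_potential_ge0 th u : 0 <= time_potential th u.
Proof. by rewrite /time_potential; case: ifP => // _;
  rewrite mulr_ge0 ?expR_ge0 ?cover_mass_ge0. Qed.

End TimePotential.

(** * The height of the tree in a sparse graph *)

Section Numerics.
Variable R : realType.

(** In the second term [(12 / 107) ^ L <= exp (- 3 L / 2)] while
    [107 r t <= L]; the exponents [18 r (D + ln n)] from [r ^ g] and [107 r t]
    from the clock leave at most [- 2 ln n]. *)
Lemma numeric_bound (n D g L : nat) (r : R) : (0 < n)%N -> 1 <= r ->
  let t := 2 * D%:R + 4 * ln n%:R in
  107 * r * t <= L%:R ->
  g%:R * ln (r ^+ 2) <= 36 * r * (D%:R + ln n%:R) ->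
  expR (- (t / 2)) * (n%:R * 2 ^+ D) +
    r ^+ g * (n.+1%:R * (12 * r) ^+ L) * (expR ((107 * r - 1) * t) * (107 * r) ^- L)
    <= 3 / n%:R.
Proof.
move=> n0 r1; set l : R := ln n%:R => t tL gl.
have np : 0 < n%:R :> R by rewrite ltr0n.
have r0 : 0 < r by apply: lt_le_trans r1.
have l0 : 0 <= l by rewrite ln_ge0 // ler1n.
have nE : n%:R = expR l by rewrite lnK.
have nV : n%:R^-1 = expR (- l) by rewrite expRN nE.
have D0 : 0 <= D%:R :> R by [].
have half : expR (- (1 / 2)) >= 1 / 2 :> R by have := expR_ge1Dx (- (1 / 2) : R); lra.
have e1 : expR (- 1) * 2 <= 1 :> R.
  have : 2 <= expR 1 :> R by have := expR_ge1Dx (1 : R); lra.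
  by rewrite expRN mulrC ler_pdivrMr ?expR_gt0 // mul1r.
have first_le : expR (- (t / 2)) * (n%:R * 2 ^+ D) <= 1 / n%:R.
  have -> : - (t / 2) = - D%:R - l - l by rewrite /t; field.
  have -> : expR (- D%:R - l - l) * (n%:R * 2 ^+ D) =
      (expR (- D%:R) * 2 ^+ D) * (expR (- l) * n%:R) * expR (- l) by rewrite !expRD; ring.
  rewrite -nV mulVf ?gt_eqF // mulr1 ler_wpM2r ?invr_ge0 //.
  rewrite -[- D%:R]mulN1r expRM_natr -exprMn.
  by rewrite exprn_ile1 // mulr_ge0 ?expR_ge0.
have second_le : r ^+ g * (n.+1%:R * (12 * r) ^+ L) *
    (expR ((107 * r - 1) * t) * (107 * r) ^- L) <= n.+1%:R * expR (- l - l).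
  have -> : r ^+ g = expR (g%:R * ln r) by rewrite expRM_natl lnK.
  have frac : (12 * r) ^+ L * (107 * r) ^- L <= expR (- (3 / 2) * L%:R) :> R.
    have -> : (12 * r) ^+ L * (107 * r) ^- L = (12 / 107) ^+ L.
      by rewrite -exprVn -exprMn; congr (_ ^+ _); field; rewrite gt_eqF.
    have e32 : 12 / 107 <= expR (- (3 / 2)) :> R.
      have -> : - (3 / 2) = - (1 / 2) + - (1 / 2) + - (1 / 2) :> R by field.
      rewrite !expRD; move: (expR _) half => x half.
      have xx : 1 / 4 <= x * x by nra.
      have xxx : 1 / 8 <= x * x * x by nra.
      lra.
    by rewrite expRM_natr; apply: lerXn2r => //; rewrite nnegrE ?expR_ge0 ?divr_ge0.
  apply: (@le_trans _ _ (n.+1%:R * (expR (g%:R * ln r) * expR ((107 * r - 1) * t) *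
    expR (- (3 / 2) * L%:R)))).
    rewrite [leLHS](_ : _ = n.+1%:R * (expR (g%:R * ln r) * expR ((107 * r - 1) * t) *
      ((12 * r) ^+ L * (107 * r) ^- L))); last by ring.
    by rewrite ler_wpM2l // ler_wpM2l // mulr_ge0 ?expR_ge0.
  rewrite ler_wpM2l // -!expRD ler_expR.
  move: gl; rewrite lnXn // mulr2n => gl.
  rewrite /t in tL *; nra.
apply: (@le_trans _ _ (1 / n%:R + n.+1%:R * expR (- l - l))); first exact: lerD.
rewrite expRD -nV -natr1.
have : n%:R^-1 <= 1 :> R by rewrite invf_le1 // ler1n.
have := mulfV (lt0r_neq0 np); move: (n%:R) (n%:R^-1) np => x y x0 xy y1.
have y0 : 0 < y by nra.
nra.
Qed.

End Numerics.

Section Assembly.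
Variables (T : finType) (e : rel T) (s : T).
Hypothesis e_sym : symmetric e.
Hypothesis e_irr : irreflexive e.
Hypothesis e_connected : forall x y, connect e x y.

Lemma short_route v : exists p, [/\ path e v p, last v p = s & (size p <= diameter e)%N].
Proof.
have /connectP[p0 p0P sE] := e_connected v s.
case/shortenP: p0P sE => p pP pu _ sE.
have has_walk : has (walk e v s) (iota 0 #|T|).
  apply/hasP; exists (size p).
    rewrite mem_iota /= add0n -[(size p).+1]/(size (v :: p)) -(card_uniqP pu);
      exact: max_card.
  by apply/existsP; exists (in_tuple p); rewrite pP -sE /=.
have := nth_find 0%N has_walk; rewrite nth_iota ?add0n; last first.
  by move: has_walk; rewrite has_find size_iota.
case/existsP=> q /andP[qP /eqP qs]; exists q; split=> //.
rewrite size_tuple; apply: leq_trans (leq_bigmax_cond v _) => //.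
exact: (leq_bigmax_cond (F := fun y => dist e v y) s).
Qed.

(** Cut a longest path to a leaf after [L] edges. *)
Lemma height_path (t : subtree T) L : (0 < L)%N -> (L <= height s t)%N ->
  exists p : L.-tuple T, [/\ path (tree_adj t) s p, uniq (s :: p) &
    forall i : 'I_L, step s p i \in t.2].
Proof.
move=> L0 Lh.
have [k [q [/and3P[qP qu _] Lk]]] : exists k : nat, exists q : k.-tuple T,
  root_to_leaf s t q /\ (L <= k)%N.
  have [/existsP[k /andP[/existsP[q qr] Lk]]|no] := boolP [exists k : 'I_#|T|,
      [exists q : k.-tuple T, root_to_leaf s t q] && (L <= k)%N]; first by exists k, q.
  suff : (height s t <= L.-1)%N by rewrite leqNgt prednK // Lh.
  apply/bigmax_leqP => k kP; rewrite -ltnS prednK // ltnNge.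
  by apply: contra no => Lk; apply/existsP; exists k; rewrite kP.
have sz : size (take L q) == L by rewrite size_takel ?size_tuple.
have tP : path (tree_adj t) s (take L q) by rewrite take_path.
exists (Tuple sz); split=> //=; first by have := take_uniq L.+1 qu.
move=> i; have /(pathP s)/(_ i) := tP; rewrite (eqP sz) => /(_ (ltn_ord i)).
by case/andP.
Qed.

Variable R : realType.
Local Notation n := (#|T|%:R : R).
Local Notation D := ((diameter e)%:R : R).
Local Notation Delta := ((max_degree e)%:R : R).

Theorem height_bound g : 
  (forall W : {set T}, (#|[set E in edges e | E \subset W]| <= 3 * #|W| + 3 * g)%N) ->
  g%:R * ln Delta <= 36 * Num.sqrt Delta * (D + ln n) ->
  1 - 3 / n <= spanning_tree_prob R e s
    (fun t => (height s t)%:R <= 107 * Num.sqrt Delta * (2 * D + 4 * ln n)).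
Proof.
move=> sparse gDelta; rewrite spanning_tree_probE.
set r := Num.sqrt Delta in gDelta *; set t := 2 * D + 4 * ln n.
set P := fun _ => _.
have n0 : (0 < #|T|)%N by apply/card_gt0P; exists s.
have np : 0 < n by rewrite ltr0n.
have [n1|n1] := leqP #|T| 1.
  have -> : #|T| = 1%N by apply/eqP; rewrite eqn_leq n1.
  by rewrite divr1 (le_trans _ (final_prob_ge0 _ _ _ _ _)) // lerBlDr add0r ler1n.
have Delta1 : 1 <= Delta.
  have [y ys] : exists y, y \notin [set s].
    have /card_gt0P[y] : (0 < #|[set~ s]|)%N by rewrite cardsC1; case: #|T| n1 => [|[]].
    by rewrite inE => ys; exists y.
  have [u [v [/set1P-> _ sv]]] := connect_exit (set11 s) ys (e_connected s y).
  rewrite ler1n; apply: (@leq_trans #|[set y | e s y]|);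
    last exact: (leq_bigmax_cond (F := fun x => #|[set y | e x y]|) s).
  by apply/card_gt0P; exists v; rewrite inE.
have r2 : r ^+ 2 = Delta by rewrite sqr_sqrtr // (le_trans _ Delta1).
have r1 : 1 <= r by rewrite -(ler_pXn2r (n := 2)) ?nnegrE ?sqrtr_ge0 // r2 expr1n.
have t0 : 0 <= t by rewrite addr_ge0 ?mulr_ge0 ?ln_ge0 ?ler1n.
have [C [out [Cg out11 cov]]] := peeling e_sym e_irr sparse.
have [route routeP] := fin_all_exists short_route.
pose L := (Num.truncn (107 * r * t)).+1.
have bound0 : 0 <= 107 * r * t by rewrite !mulr_ge0 // (le_trans _ r1).
have tL : 107 * r * t < L%:R by rewrite -truncn_lt_nat.
have -> : final_prob R e #|T|.-1 P (seed s) = 1 - final_prob R e #|T|.-1 (predC P) (seed s).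
  by rewrite -(final_prob_compl R s e_sym e_irr e_connected P) addrK.
rewrite lerD2l lerN2.
pose paths := [set p : L.-tuple T | path e s p && uniq (s :: p)].
pose lam := 107 * r - 1.
have lam0 : 0 <= lam by rewrite subr_ge0; lra.
pose Phi th u := time_potential route t th u + \sum_(p in paths) path_potential s p lam t
  th u.
apply: (@le_trans _ _ (Phi 0 (seed s))).
  apply: (final_prob_le e_sym e_irr e_connected (Phi := Phi)) => [u th gu uT|u th gu uT b0].
    rewrite /predC /=; have [Pu|Pu] := boolP (P u).
      by rewrite addr_ge0 ?time_potential_ge0 ?sumr_ge0 // => p _;
        apply: path_potential_ge0.
    rewrite /Phi; have [tth|tht] := ltP t th.
      rewrite /time_potential tth lerDl sumr_ge0 // => p _.
      exact: path_potential_ge0.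
    have Lh : (L <= height s u)%N.
      by move: Pu; rewrite /P -ltNge -/r -/t -truncn_lt_nat.
    have [p [pP pu pE]] := height_path (isT : (0 < L)%N) Lh.
    have pS : p \in paths.
      rewrite inE pu andbT; apply: sub_path pP => x y /andP[_ xy].
      by rewrite -edges2 //; have [_ /subsetP ue _] := gu; apply: ue.
    rewrite (bigD1 p) //= (le_trans (path_potential_final lam0 pE tht)) //.
    rewrite addrCA lerDl addr_ge0 ?time_potential_ge0 ?sumr_ge0 // => q _.
    exact: path_potential_ge0.
  rewrite /Phi big_split /= mulrDr lerD //;
    first by apply: (time_potential_step (s := s)) => // v; have [] := routeP v.
  rewrite exchange_big /= mulr_sumr; apply: ler_sum => p /setIdP[pP pu].
  exact: path_potential_step.
rewrite /Phi (eq_bigr (fun=> expR (lam * t) * (107 * r) ^- L)); last first.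
  by move=> p /setIdP[pP pu];
    rewrite path_potential_seed // (_ : 1 + lam = 107 * r) // /lam addrC subrK.
rewrite sumr_const -[(expR _ * _) *+ _]mulr_natl.
have := numeric_bound (n := #|T|) (D := diameter e) (g := g) (L := L) n0 r1 (ltW tL).
rewrite r2 => /(_ gDelta); apply: le_trans; apply: lerD.
  by apply: time_potential_seed => // v; have [] := routeP v.
rewrite ler_wpM2r ?mulr_ge0 ?expR_ge0 ?invr_ge0 ?exprn_ge0 ?mulr_ge0 ?(le_trans _ r1) //.
apply: (path_count r1 _ out11 e_sym cov s L Cg) => x; rewrite r2 ler_nat.
exact: (leq_bigmax_cond (F := fun x => #|[set y | e x y]|) x).
Qed.

End Assembly.

(** * From drawings on surfaces to minors of triangulations *)

From mathcomp Require Import all_classical all_reals all_analysis.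
Import numFieldNormedType.Exports.
Local Open Scope classical_set_scope.

Section Stars.
Variables (R : realType) (N m : nat) (K : {set {set 'I_N}}).
Hypothesis m_gt0 : (0 < m)%N.
Hypothesis K3 : forall F, F \in K -> #|F| = 3%N.
Implicit Types (a b : lattice N m) (x y : 'rV[R]_N).
Local Notation vertex := (@vertex N m K).
Local Notation ends := (@ends N m K).

(** The open star of the vertex [a / m] in the subdivision, described in
    barycentric coordinates. *)
Definition star a : set 'rV[R]_N :=
  [set x | forall i, `|m%:R * x ord0 i - (a i)%:R| < 1].

Lemma star_open a : open (star a).
Proof.
rewrite openE => x xa.
apply: (@filter_forall _ _ (fun i =>
  [set y : 'rV[R]_N | `|m%:R * y ord0 i - (a i)%:R| < 1]) (nbhs x)) => i.
have cf : {for x, continuous (fun y : 'rV[R]_N => `|m%:R * y ord0 i - (a i)%:R|)}.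
  apply: continuous_comp; last exact: norm_continuous.
  apply: continuousB; last exact: cst_continuous.
  by apply: continuousM; [exact: cst_continuous|exact: coord_continuous].
have := cf; move=> /(_ [set r | r < 1]); apply.
by apply: open_nbhs_nbhs; split; [exact: open_lt|exact: xa].
Qed.

Lemma star_small a x y i : star a x -> star a y ->
  m%:R * `|x ord0 i - y ord0 i| < 2.
Proof.
move=> /(_ i) xa /(_ i) ya.
have -> : m%:R * `|x ord0 i - y ord0 i| =
    `|(m%:R * x ord0 i - (a i)%:R) - (m%:R * y ord0 i - (a i)%:R)|.
  rewrite -{1}[m%:R]ger0_norm // -normrM; congr `|_|; ring.
by rewrite (le_lt_trans (ler_normB _ _)) // (_ : 2 = 1 + 1) // ltrD.
Qed.

Lemma star_supp a F x : F \in K -> (forall i, x ord0 i != 0 -> i \in F) ->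
  star a x -> supp a \subset F.
Proof.
move=> FK xF xa; apply/fintype.subsetP=> i; rewrite inE => ai; apply: xF.
apply/eqP=> xi; have := xa i; rewrite xi mulr0 sub0r normrN normr_nat.
by rewrite ltrn1; lia.
Qed.

(** Round the coordinates of [m x] down, and then as many of the fractional
    ones up as are needed to restore the sum [m]. *)
Lemma realization_star x : realization K x -> exists v : vertex, star (val v) x.
Proof.
case=> x0 x1 [F FK xF].
pose y i : R := m%:R * x ord0 i.
have y0 i : 0 <= y i by rewrite mulr_ge0.
have y1 : \sum_i y i = m%:R by rewrite -mulr_sumr x1 mulr1.
pose n i := Num.truncn (y i).
have nP i : (n i)%:R <= y i < (n i).+1%:R by apply: truncn_itv.
(* The coordinates that may be rounded up; there are enough of them, as each
   fractional part is less than 1. *)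
pose Z := [set i | (n i)%:R < y i]%SET.
have nm : (\sum_i n i <= m)%N.
  rewrite -(ler_nat R) natr_sum -y1; apply: ler_sum => i _.
  by case/andP: (nP i).
have mZ : (m <= \sum_i n i + #|Z|)%N.
  rewrite -(ler_nat R) natrD natr_sum -y1 -sum1_card natr_sum [X in _ + X]big_mkcond /=
    -big_split /=.
  apply: ler_sum => i _; case/andP: (nP i) => n1 n2; rewrite inE.
  case: ifP => [_|/negbT]; last by rewrite -leNgt addr0.
  by rewrite (le_trans (ltW n2)) // -natr1.
have [Y /setIdP[YZ /eqP cY]] : exists Y : {set 'I_N},
  Y \in [set Y : {set 'I_N} | Y \subset Z & #|Y| == (m - \sum_i n i)%N]%SET.
  by apply/card_gt0P; rewrite cards_draws bin_gt0 leq_subLR.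
pose a0 i : nat := (n i + (i \in Y))%N.
have a0m : (\sum_i a0 i = m)%N.
  by rewrite big_split /= -[X in (_ + X)%N]big_mkcond /= sum1_card cY subnKC.
pose a : lattice N m := [ffun i => inord (a0 i)].
have aE i : a i = a0 i :> nat.
  have le : (a0 i <= m)%N by rewrite -a0m (bigD1 i) //= leq_addr.
  by rewrite ffunE inordK //; lia.
have star_a : star a x.
  move=> i; rewrite aE /a0 -/(y i); case/andP: (nP i) => n1 n2.
  have [iY|iY] := boolP (i \in Y).
    have := fintype.subsetP YZ _ iY; rewrite inE addn1 => n3.
    by rewrite ltr_norml -natr1; rewrite -natr1 in n2; lra.
  by rewrite addn0 ltr_norml; rewrite -natr1 in n2; lra.
have va : is_vertex K a.
  apply/andP; split; first by rewrite /mass; under eq_bigr => i _ do rewrite aE;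
    rewrite a0m.
  by apply/exists_inP; exists F => //; apply: star_supp FK xF star_a.
by exists (Sub a va).
Qed.

(** Two vertices whose stars share a point of the face [F] differ by at most 1
    in each coordinate, and their coordinates have equal sums.  As [F] has
    only three coordinates, they differ by [e_i - e_j]. *)
Lemma star_adjacent x (v w : vertex) : realization K x ->
  star (val v) x -> star (val w) x -> v = w \/ linked ends [set: _]%SET v w.
Proof.
move=> [_ _ [F FK xF]] xv xw.
have vF := star_supp FK xF xv; have wF := star_supp FK xF xw.
have /andP[/eqP mv _] := valP v; have /andP[/eqP mw _] := valP w.
have [a aE] : exists a, val v = a by exists (val v).
have [b bE] : exists b, val w = b by exists (val w).
rewrite aE in xv vF mv; rewrite bE in xw wF mw.
rename xv into xa, xw into xb, vF into aF, wF into bF, mv into ma, mw into mb.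
have close i : (a i <= b i + 1)%N /\ (b i <= a i + 1)%N.
  have := xa i; have := xb i; rewrite !ltr_norml => /andP[b1 b2] /andP[a1 a2].
  by split; rewrite -ltnS -(ltr_nat R) -addnS natrD; lra.
have [ab|/eqP nab] := pselect (a = b).
  by left; apply: val_inj; rewrite aE bE.
right.
have diff (c d : lattice N m) : mass c = m -> mass d = m -> c != d ->
  exists i, (c i < d i)%N.
  move=> mc md; apply: contra_neqP => /forallNP le.
  apply: latticeP => i; apply/eqP; rewrite eq_sym eqn_leq leqNgt; have /negP -> /= := le i.
  rewrite leqNgt; apply/negP => lt.
  have : (mass d < mass c)%N.
    rewrite /mass (bigD1 i) //= [ltnRHS](bigD1 i) //= -addSn leq_add //.
    by apply: leq_sum => j _; rewrite leqNgt; apply/negP.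
  by rewrite mc md ltnn.
have [j abj] := diff a b ma mb nab.
have [i bai] : exists i, (b i < a i)%N by apply: diff => //; rewrite eq_sym.
have ij : i != j by apply: contraTneq bai => ->; rewrite -leqNgt ltnW.
(* The third coordinate of [F] is determined by the sum. *)
have rest k : k != i -> k != j -> a k = b k :> nat.
  move=> ki kj; have [kF|kF] := boolP (k \in F); last first.
    have nz (c : lattice N m) : supp c \subset F -> c k = 0%N :> nat.
      by move=> cF; apply/eqP; rewrite -leqn0 leqNgt; apply: contra kF => ck;
         apply: (fintype.subsetP cF); rewrite inE.
    by rewrite !nz.
  have sumF (c : lattice N m) : supp c \subset F -> (mass c = c i + (c j + c k))%N.
    move=> cF; rewrite /mass (bigID (mem F)) /= [X in (_ + X)%N]big1 ?addn0; last first.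
      by move=> l lF; apply/eqP; rewrite -leqn0 leqNgt; apply: contra lF => cl;
         apply: (fintype.subsetP cF); rewrite inE.
    have iF : i \in F by apply: (fintype.subsetP aF); rewrite inE (leq_ltn_trans _ bai).
    have jF : j \in F by apply: (fintype.subsetP bF); rewrite inE (leq_ltn_trans _ abj).
    have FE : F = [set i; j; k]%SET.
      apply/esym/eqP; rewrite eqEcard !finset.subUset !finset.sub1set iF jF kF (K3 FK) /=.
      rewrite finset.setUC cardsU1 cards2 ij !inE negb_or ki kj //.
    rewrite FE finset.setUC big_setU1 ?inE ?negb_or ?ki ?kj //= big_setU1 ?inE //= big_set1;
      by rewrite addnC -addnA.
  have := sumF a aF; have := sumF b bF; rewrite ma mb.
  have := close i; have := close j; lia.
have ta : mass (incr a j) = m.+1 by rewrite mass_incr ?ma.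
have bi : decr (incr a j) i = b.
  apply: latticeP => k; rewrite decrE incrE ?ma //.
  have [ci1 ci2] := close i; have [cj1 cj2] := close j.
  have [->|ki] := eqVneq k i; first by rewrite (negbTE ij); lia.
  have [->|kj] := eqVneq k j; first by lia.
  by rewrite rest //; lia.
have jF : j \in F by apply: (fintype.subsetP bF); rewrite inE (leq_ltn_trans _ abj).
have sa : supp (incr a j) = (j |: supp a)%SET by rewrite supp_incr ?ma.
have pe : is_edge K (incr a j, [set i; j]%SET).
  rewrite /is_edge /= ta eqxx cards2 ij /=; apply/andP; split.
    by apply/exists_inP; exists F => //; rewrite sa finset.subUset finset.sub1set jF.
  by rewrite sa finset.subUset !finset.sub1set !in_setU1 eqxx inE (leq_ltn_trans _ bai)
    // orbT.
apply: (vlinkI pe); rewrite ?aE ?bE /end_of /=; apply/exists_inP.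
  by exists j; rewrite ?inE ?eqxx ?orbT // incrK ?ma.
by exists i; rewrite ?inE ?eqxx // bi.
Qed.

End Stars.

Section Touched.
Variables (R : realType) (N m : nat) (K : {set {set 'I_N}}).
Hypothesis m_gt0 : (0 < m)%N.
Hypothesis K3 : forall F, F \in K -> #|F| = 3%N.
Local Notation vertex := (@vertex N m K).
Local Notation adj := (linked (@ends N m K) [set: _]%SET).
Implicit Types (X Y : set 'rV[R]_N) (v w : vertex).

Definition touched X : {set vertex} :=
  [set v : vertex | `[< exists2 x, X x & star (val v) x >]]%SET.

Lemma touchedP X v : reflect (exists2 x, X x & star (val v) x) (v \in touched X).
Proof. by rewrite inE; apply: asboolP. Qed.

Lemma touched_in X x : X x -> realization K x ->
  exists2 v, v \in touched X & star (val v) x.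
Proof.
move=> Xx /(realization_star m_gt0)[v vx]; exists v => //.
by apply/touchedP; exists x.
Qed.

(** The stars of one component of [touched X] and the stars of the others would
    split [X] into two open sets. *)
Lemma touched_connected X v w : connected X -> X `<=` realization K ->
  v \in touched X -> w \in touched X -> connect (rel_on adj (touched X)) v w.
Proof.
move=> cX XK vX wX.
pose C u := connect (rel_on adj (touched X)) v u.
pose O1 := \bigcup_(u in [set u | C u]) star (R := R) (val u).
pose O2 := \bigcup_(u in [set u | u \in touched X /\ ~~ C u]) star (R := R) (val u).
have O1open : open O1 by apply: bigcup_open => u _; apply: star_open.
have O2open : open O2 by apply: bigcup_open => u _; apply: star_open.
have cover x : X x -> O1 x \/ O2 x.
  move=> Xx; have [u uX ux] := touched_in Xx (XK x Xx).
  by have [uC|uC] := boolP (C u); [left|right]; exists u.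
have disj x : X x -> O1 x -> O2 x -> False.
  move=> Xx [u uC ux] [u' [u'X u'C] u'x].
  have uX : u \in touched X by apply/touchedP; exists x.
  have [uu|uu] := star_adjacent m_gt0 K3 (XK x Xx) ux u'x.
    by move: u'C; rewrite -uu; move/negP; apply.
  move/negP: u'C; apply; apply: connect_trans uC (connect1 _).
  by apply/and3P.
have XO1 : X `&` O1 = X.
  apply: cX.
  - case/touchedP: vX => x Xx vx; exists x; split => //; exists v => //.
    exact: connect0.
  - by exists O1.
  - exists (~` O2); first exact: open_closedC.
    apply/seteqP; split=> x [Xx Ox]; split=> //; first by move=> /(disj x Xx Ox).
    by case: (cover x Xx).
case/touchedP: (wX) => x Xx wx; have [|wC] := boolP (C w); first by [].
have [_ Ox] : (X `&` O1) x by rewrite XO1.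
by exfalso; apply: (disj x Xx Ox); exists w.
Qed.

End Touched.

(** Disjoint compact sets have positive distance, and a star has diameter less
    than [2 / m]. *)
Lemma touched_disjoint (R : realType) (N : nat) (K : {set {set 'I_N}})
    (X Y : set 'rV[R]_N) : compact X -> compact Y -> X `&` Y = set0 ->
  \forall m \near \oo, forall v : @vertex N m K, v \in touched m K X ->
    v \in touched m K Y -> False.
Proof.
move=> cX cY XY.
pose P (m : nat) (p : 'rV[R]_N * 'rV[R]_N) := exists i,
  2 <= m%:R * `|p.1 ord0 i - p.2 ord0 i|.
suff: \forall m \near \oo, X `*` Y `<=` P m.
  apply: filterS => m far v /touchedP[x Xx vx] /touchedP[y Yy vy].
  have [i] := far (x, y) (conj Xx Yy); rewrite leNgt => /negP; apply.
  exact: star_small vx vy.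
have /compact_near_coveringP := compact_setX cX cY; apply.
move=> -[x y] [/= Xx Yy].
have [i xy] : exists i, x ord0 i != y ord0 i.
  apply: contrapT => /forallNP eqxy; suff xy : x = y.
    by have : (X `&` Y) x by [split=> //; rewrite xy]; rewrite XY.
  by apply/matrixP=> j i; rewrite !ord1; apply/eqP; apply: contrapT => /negP/eqxy.
pose d := `|x ord0 i - y ord0 i| / 2.
have d0 : 0 < d by rewrite divr_gt0 // normr_gt0 subr_eq0.
have near_d : nbhs ((x, y) : 'rV[R]_N * 'rV[R]_N)
    [set p : 'rV[R]_N * 'rV[R]_N | d < `|p.1 ord0 i - p.2 ord0 i|].
  have c1 : continuous (fun p : 'rV[R]_N * 'rV[R]_N => p.1 ord0 i).
    move=> p; apply: (@continuous_comp _ _ _ fst (fun M : 'rV[R]_N => M ord0 i)).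
      exact: cvg_fst.
    exact: coord_continuous.
  have c2 : continuous (fun p : 'rV[R]_N * 'rV[R]_N => p.2 ord0 i).
    move=> p; apply: (@continuous_comp _ _ _ snd (fun M : 'rV[R]_N => M ord0 i)).
      exact: cvg_snd.
    exact: coord_continuous.
  have cf : {for (x, y), continuous (fun p : 'rV[R]_N * 'rV[R]_N =>
    `|p.1 ord0 i - p.2 ord0 i|)}.
    apply: continuous_comp; last exact: norm_continuous.
    by apply: continuousB; [exact: c1|exact: c2].
  have := cf; move=> /(_ [set r | d < r]); apply.
  apply: open_nbhs_nbhs; split; first exact: open_gt.
  by rewrite /= /d ltr_pdivrMr // ltr_pMr ?normr_gt0 ?subr_eq0 // ltr1n.
have near_m : \forall m \near \oo, 2 / d < m%:R by apply: nbhs_infty_gtr.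
exists ([set p : 'rV[R]_N * 'rV[R]_N | d < `|p.1 ord0 i - p.2 ord0 i|],
        [set m : nat | 2 / d < m%:R]) => //= -[p m] [/= pd md].
exists i; rewrite ltW // (@lt_trans _ _ (m%:R * d)) //.
  by rewrite -ltr_pdivrMr.
by rewrite ltr_pM2l // (lt_trans _ md) // divr_gt0.
Qed.

Lemma bigcup_finType_compact (I : finType) (X : topologicalType) (A : I -> set X) :
  (forall i, compact (A i)) -> compact (\bigcup_i A i).
Proof.
move=> cA; rewrite (_ : \bigcup_i A i = \bigcup_(i in [set` enum I]) A i).
  by rewrite bigcup_seq; apply: bigsetU_compact.
by apply/seteqP; split=> x [i _ ix]; exists i => //=; rewrite mem_enum.
Qed.

Section Drawing.
Variables (R : realType) (T : finType) (e : rel T) (N : nat) (K : {set {set 'I_N}}).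
Variables (S : topologicalType) (f : S -> 'rV[R]_N).
Variables (phi : T -> S) (gamma : {set T} -> R -> S).
Hypothesis f_continuous : continuous f.
Hypothesis f_inj : injective f.
Hypothesis f_real : range f `<=` realization K.
Hypothesis drawn : drawing e phi gamma.

Definition third (b : bool) : set R := if b then `[2 / 3, 1]%classic else `[0,
  1 / 3]%classic.

(** An index [p] that does not describe an arc starting at [v] yields the
    point of [v], so that every arm contains this point and the hub is a union
    over a finite type. *)
Definition arm v (p : option ({set T} * bool)) : set 'rV[R]_N :=
  if p is Some (E, b) then
    if (E \in edges e) && `[< gamma E b%:R = phi v >]
    then (f \o gamma E) @` third b else [set f (phi v)]
  else [set f (phi v)].

Definition hub v := \bigcup_p arm v p.

Definition mid E := (f \o gamma E) @` `[1 / 3, 2 / 3].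

Lemma arc_continuous E (A : set R) : E \in edges e -> A `<=` `[0, 1] ->
  {within A, continuous (f \o gamma E)}.
Proof.
move=> Ee A01; case: drawn => _ /(_ E Ee)[cE _ _] _ _.
have {}cE := continuous_subspaceW A01 cE.
move=> x; exact: (@continuous_comp (subspace A) S _ (gamma E) f x (cE x) (@f_continuous _)).
Qed.

Lemma third01 b : third b `<=` `[0, 1].
Proof. by move=> t; case: b; rewrite /third /= !in_itv /=; lra. Qed.

Lemma mid01 : `[1 / 3, 2 / 3] `<=` (`[0, 1] : set R).
Proof. by move=> t; rewrite /= !in_itv /=; lra. Qed.

Lemma compact_third b : compact (third b).
Proof. by case: b; apply: segment_compact. Qed.

Lemma connected_third b : connected (third b).
Proof. by case: b; apply: segment_connected. Qed.

Lemma arm_compact v p : compact (arm v p).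
Proof.
case: p => [[E b]|] /=; last exact: compact_set1.
case: ifP => [/andP[Ee _]|_]; last exact: compact_set1.
apply: continuous_compact (@compact_third b).
exact: arc_continuous Ee (@third01 b).
Qed.

Lemma arm_connected v p : connected (arm v p).
Proof.
case: p => [[E b]|] /=; last exact: connected1.
case: ifP => [/andP[Ee _]|_]; last exact: connected1.
apply: connected_continuous_connected (@connected_third b) _.
exact: arc_continuous Ee (@third01 b).
Qed.

Lemma arm_center v p : arm v p (f (phi v)).
Proof.
case: p => [[E b]|] //=; case: ifP => [/andP[_ /asboolP bv]|//].
exists b%:R; last by rewrite /= bv.
by case: b {bv}; rewrite /third /= in_itv /=; lra.
Qed.

Lemma hub_center v : hub v (f (phi v)).
Proof. by exists None. Qed.

Lemma hub_compact v : compact (hub v).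
Proof. by apply: bigcup_finType_compact => p; apply: arm_compact. Qed.

Lemma hub_connected v : connected (hub v).
Proof.
apply: bigcup_connected => [|p _]; last exact: arm_connected.
by exists (f (phi v)) => p _; apply: arm_center.
Qed.

Lemma hub_sub v : hub v `<=` realization K.
Proof.
move=> x [[[E b]|] _] /=; last by move=> ->; apply: f_real.
by case: ifP => _ => [[t _ <-]|->]; apply: f_real.
Qed.

Lemma mid_compact E : E \in edges e -> compact (mid E).
Proof.
move=> Ee; apply: continuous_compact (@segment_compact _ _ _).
exact: arc_continuous Ee mid01.
Qed.

Lemma mid_connected E : E \in edges e -> connected (mid E).
Proof.
move=> Ee; apply: connected_continuous_connected (@segment_connected _ _ _) _.
exact: arc_continuous Ee mid01.
Qed.

Lemma mid_sub E : mid E `<=` realization K.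
Proof. by move=> x [t _ <-]; apply: f_real. Qed.

(** A point of a hub other than its centre is interior to an arc, where the
    drawing has no crossings. *)
Lemma hubP v s : hub v (f s) -> s = phi v \/ exists E (b : bool) t,
  [/\ E \in edges e, gamma E b%:R = phi v, third b t, 0 < t < 1 & s = gamma E t].
Proof.
case=> -[[E b]|] _ /=; last by move=> /f_inj; left.
case: ifP => [/andP[Ee /asboolP bv]|_]; last by move=> /f_inj; left.
case=> t tb /f_inj <-.
have [t01|t01] := boolP (0 < t < 1); first by right; exists E, b, t.
left; rewrite -bv; congr gamma; move: tb t01; rewrite /third.
by case: b {bv}; rewrite /= in_itv /= => /andP[t0 t1];
  rewrite negb_and -!leNgt => /orP[]; lra.
Qed.

Lemma hub_disjoint v w : v != w -> hub v `&` hub w = set0.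
Proof.
case: drawn => phi_inj arcs d3 d4 vw; apply/seteqP; split=> // x [xv xw].
have [s xE] : exists s, x = f s.
  case: xv => -[[E b]|] _ /=; last by move=> ->; exists (phi v).
  by case: ifP => _ => [[t _ <-]|->]; [exists (gamma E t)|exists (phi v)].
rewrite xE in xv xw; move/eqP: vw; apply.
case: (hubP xv) => [sv|[E [b [t [Ee bv tb t01 st]]]]];
  case: (hubP xw) => [sw|[E' [b' [t' [Ee' bw tb' t01' st']]]]].
- by apply: phi_inj; rewrite -sv sw.
- by exfalso; apply: (d3 E' v t' Ee' t01'); rewrite -st' sv.
- by exfalso; apply: (d3 E w t Ee t01); rewrite -st sw.
have [EE|EE] := eqVneq E E'; last first.
  by exfalso; apply: (d4 E E' t t' Ee Ee' EE t01 t01'); rewrite -st st'.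
subst E'; apply: phi_inj; rewrite -bv -bw; congr (gamma E _).
have [_ gi _] := arcs E Ee.
have tt' : t = t'.
  apply: gi; rewrite ?in_itv /= ?ltW ?(andP t01).1 ?(andP t01).2 ?(andP t01').1 ?(andP
    t01').2 //.
  by rewrite -st st'.
move: tb tb'; rewrite -tt' /third; case: b bv => _; case: b' bw => _ //=;
  rewrite !in_itv /=; lra.
Qed.

Lemma mid_disjoint E E' : E \in edges e -> E' \in edges e -> E != E' ->
  mid E `&` mid E' = set0.
Proof.
case: drawn => phi_inj arcs d3 d4 Ee Ee' EE; apply/seteqP;
  split=> // x [[t tm <-] [t' tm']] /f_inj.
move/esym; apply: d4 => //; [move: tm|move: tm']; rewrite /= in_itv /=; lra.
Qed.

Lemma mid_hub_disjoint E v : E \in edges e -> v \notin E -> mid E `&` hub v = set0.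
Proof.
case: drawn => phi_inj arcs d3 d4 Ee vE; apply/seteqP; split=> // x [[t tm <-]] /hubP.
have t01 : 0 < t < 1 by move: tm; rewrite /= in_itv /=; lra.
case=> [|[E' [b [t' [Ee' bv _ t01' tt']]]]]; first exact: d3.
have [EE|EE] := eqVneq E E'; last exact: (d4 E E' t t' Ee Ee' EE t01 t01').
subst E'; have [_ _ gE] := arcs E Ee.
have : [set gamma E 0; gamma E 1] (phi v) by rewrite -bv; case: (b); [right|left].
by rewrite gE => -[u uE /phi_inj uv]; move: vE; rewrite -uv /= uE.
Qed.

Lemma mid_hub_meet E v : E \in edges e -> v \in E -> exists2 x, mid E x & hub v x.
Proof.
case: drawn => phi_inj arcs d3 d4 Ee vE; have [_ _ gE] := arcs E Ee.
have : [set gamma E 0; gamma E 1] (phi v) by rewrite gE; exists v.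
have hub_arm (b : bool) t : gamma E b%:R = phi v -> third b t -> hub v (f (gamma E t)).
  move=> bv tb; exists (Some (E, b)) => //=; rewrite Ee; case: ifP => [_|/negP[]].
    by exists t.
  exact/asboolP.
case=> [g0|g1].
  exists (f (gamma E (1 / 3))); first by exists (1 / 3) => //=; rewrite in_itv /=; lra.
  by apply: (hub_arm false); rewrite /third /= ?in_itv /=; [exact/esym|lra].
exists (f (gamma E (2 / 3))); first by exists (2 / 3) => //=; rewrite in_itv /=; lra.
by apply: (hub_arm true); rewrite /third /= ?in_itv /=; [exact/esym|lra].
Qed.

End Drawing.

(** For large [m], the vertices of the subdivision that are touched by the hubs
    and by the middle thirds form a model of the subgraph induced on [W]. *)
Theorem drawable_sparse (R : realType) (T : finType) (e : rel T) (g : nat) (W : {set T}) :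
  irreflexive e -> drawable_in_genus R e g ->
  (#|[set E in edges e | E \subset W]%SET| <= 3 * #|W| + 3 * g)%N.
Proof.
move=> e_irr [S [[_ [N [K [[[[_ K3] K2 _ Kc] [f [f_cont f_inj f_range]]] chi]]]]]].
move=> [phi [gamma drawn]].
have f_real : range f `<=` realization K by rewrite f_range.
have hc v : compact (hub e f phi gamma v) by apply: hub_compact.
have mc E : E \in edges e -> compact (mid f gamma E) by move=> Ee;
  apply: (mid_compact f_cont drawn).
have [m [m_gt0 hubs mids mid_hubs]] : exists m : nat, [/\ (0 < m)%N,
    forall v w, v != w -> forall u, u \in touched m K (hub e f phi gamma v) ->
      u \in touched m K (hub e f phi gamma w) -> False,
    forall E E', E \in edges e -> E' \in edges e -> E != E' ->
      forall u, u \in touched m K (mid f gamma E) ->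
        u \in touched m K (mid f gamma E') -> False &
    forall E v, E \in edges e -> v \notin E ->
      forall u, u \in touched m K (mid f gamma E) ->
        u \in touched m K (hub e f phi gamma v) -> False].
  have near1 : \forall m \near \oo, forall p : T * T, p.1 != p.2 ->
      forall u, u \in touched m K (hub e f phi gamma p.1) ->
      u \in touched m K (hub e f phi gamma p.2) -> False.
    apply: filter_forall => -[v w] /=; have [vw|vw] := boolP (v != w).
      have := touched_disjoint K (@hc v)
        (@hc w) (hub_disjoint f_inj drawn vw).
      by apply: filterS => m far _; exact: far.
    by apply: filterE.
  have near2 : \forall m \near \oo, forall p : {set T} * {set T},
      p.1 \in edges e -> p.2 \in edges e -> p.1 != p.2 ->
      forall u, u \in touched m K (mid f gamma p.1) ->
      u \in touched m K (mid f gamma p.2) -> False.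
    apply: filter_forall => -[E E'] /=.
    have [/and3P[Ee Ee' EE]|no] := boolP [&& E \in edges e, E' \in edges e & E != E'].
      have := touched_disjoint K (@mc _ Ee)
        (@mc _ Ee') (mid_disjoint f_inj drawn Ee Ee' EE).
      by apply: filterS => m far _ _ _; exact: far.
    by apply: filterE => m Ee Ee' EE; rewrite Ee Ee' EE in no.
  have near3 : \forall m \near \oo, forall p : {set T} * T,
      p.1 \in edges e -> p.2 \notin p.1 ->
      forall u, u \in touched m K (mid f gamma p.1) ->
      u \in touched m K (hub e f phi gamma p.2) -> False.
    apply: filter_forall => -[E v] /=.
    have [/andP[Ee vE]|no] := boolP ((E \in edges e) && (v \notin E)).
      have := touched_disjoint K (@mc _ Ee)
        (@hc v) (mid_hub_disjoint f_inj drawn Ee vE).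
      by apply: filterS => m far _ _; exact: far.
    by apply: filterE => m Ee vE; rewrite Ee vE in no.
  have [m [m0 [n1 [n2 n3]]]] :=
    filter_ex (filterI (nbhs_infty_gt 0) (filterI near1 (filterI near2 near3))).
  exists m; split=> // [v w|E E'|E v];
    [exact: (n1 (v, w))|exact: (n2 (E, E'))|exact: (n3 (E, v))].
pose V := {x : T | x \in W}.
pose Eg := {E : {set T} | (E \in edges e) && (E \subset W)}.
have cardV : #|{: V}| = #|W| by rewrite card_sig; apply: eq_card => x; rewrite !inE.
have <- : #|{: Eg}| = #|[set E in edges e | E \subset W]%SET|.
  by rewrite card_sig; apply: eq_card => E; rewrite !inE.
have /fin_all_exists[st stP] (E : Eg) : exists p : V * V,
    p.1 != p.2 /\ val E = [set val p.1; val p.2]%SET.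
  have /andP[/edgesE[x [y [xy EE]]] EW] := valP E.
  have [xW yW] : x \in W /\ y \in W.
    by move: EW; rewrite EE finset.subUset !finset.sub1set => /andP.
  exists (Sub x xW, Sub y yW); rewrite /= EE; split=> //.
  by apply: contraTneq xy => /(congr1 val) /= ->; rewrite e_irr.
have stE (E : Eg) : val E = [set val v | v in [set (st E).1; (st E).2]]%SET.
  by rewrite imsetU1 imset_set1 (stP E).2.
have Ee (E : Eg) : val E \in edges e by have /andP[] := valP E.
have injE (E E' : Eg) : val E = val E' -> E = E' by apply: val_inj.
have mE (E : Eg) := mid_connected f_cont drawn (Ee E).
have mR (E : Eg) := @mid_sub R T N K S f gamma f_real (val E).
rewrite -cardV.
apply: (@touching_sets_sparse _ _ _ (@ends N m K) (@sides N m K) _ _ _ _ _ V Eg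
  (fun E => (st E).1) (fun E => (st E).2) _ _
  (fun v => touched m K (hub e f phi gamma (val v)))
  (fun E => touched m K (mid f gamma (val E)))).
- exact: ends2.
- apply: (sides2 K3).
  by move=> A A2 fA; apply: K2; rewrite inE A2 eqxx.
- exact: (boundary_even K3).
- exact: (vertices_connected m_gt0 K3 Kc).
- exact: (triangles_connected m_gt0 K3 Kc).
- by move=> E; rewrite (stP E).1.
- by move=> E E' /= EE; apply: injE; rewrite !stE EE.
- move=> v; apply/set0Pn.
  have [x xv _] := touched_in m_gt0 (hub_center e f phi gamma (val v)) (hub_sub f_real
    (hub_center e f phi gamma (val v))).
  by exists x.
- move=> v w x xv xw; apply: val_inj; apply/eqP; apply: contrapT => /negP vw.
  exact: hubs vw x xv xw.
- by move=> v x y; apply: touched_connected => //; [exact: hub_connected|exact: hub_sub].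
- move=> E E' x xE xE'; apply: injE; apply/eqP; apply: contrapT => /negP EE.
  exact: mids (Ee E) (Ee E') EE x xE xE'.
- by move=> E x y; apply: touched_connected.
- move=> E; have [|x xm xh] :=
  @mid_hub_meet _ _ _ _ _ f _ _ drawn (val E) (val (st E).1) (Ee E).
    by rewrite stE imset_f // !inE eqxx.
  have [u um ux] := touched_in m_gt0 xm (mR E x xm); exists u => //.
  by apply/touchedP; exists x.
- move=> E; have [|x xm xh] :=
  @mid_hub_meet _ _ _ _ _ f _ _ drawn (val E) (val (st E).2) (Ee E).
    by rewrite stE imset_f // !inE eqxx orbT.
  have [u um ux] := touched_in m_gt0 xm (mR E x xm); exists u => //.
  by apply/touchedP; exists x.
- move=> E v x xE xv; apply: contrapT => /negP vE;
  apply: (mid_hubs (val E) (val v)) xE xv => //.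
  by rewrite stE mem_imset.
have := @euler_subdivision N m K m_gt0 K3; move: chi; rewrite /euler_char.
have scE d : simplex_count K d = #|simplices K d| by [].
rewrite !scE; move: #|simplices K 1| #|simplices K 2| #|simplices K 3| => s1 s2 s3.
move: #|{: vertex m K}| #|{: edge m K}| #|{: triangle m K}| => c1 c2 c3; lia.
Qed.

Local Close Scope classical_set_scope.

(** * The theorem *)

Theorem theorem3 (R : realType) :
  exists2 A : R, 0 < A &
    forall (T : finType) (e : rel T) (g : nat) (s : T),
      simple_connected_graph e ->
      has_euler_genus R e g ->
      let n : R := #|T|%:R in
      let D : R := (diameter e)%:R in
      let Delta : R := (max_degree e)%:R in
      g%:R * ln Delta <= 36 * Num.sqrt Delta * (D + ln n) ->
      1 - A / n <=
        spanning_tree_prob R e s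
          (fun t => (height s t)%:R
                      <= 107 * Num.sqrt Delta * (2 * D + 4 * ln n)).
Proof.
exists 3 => // T e g s [e_sym e_irr e_connected] [drawn _] /=.
by apply: height_bound => // W; apply: drawable_sparse drawn.
Qed.
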